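(* Let $M\ge 1$ be an integer and let $q\in(1,M+1]$. The following statements are equivalent: (i) $q\in\mathcal{U}$; (ii) $\dim_H \pi_{M+1}(\mathcal{U}_r'\setminus\mathcal{U}_q')>0$ for every $r\in(q,M+1]$; (iii) $\dim_H\big(\mathcal{U}\cap(q,r)\big)>0$ for every $r\in(q,M+1]$.
   Context: Fix an integer $M\ge1$. For $q>1$ and a sequence $(d_i)\in\{0,1,\ldots,M\}^\infty$ write $\pi_q((d_i))=\sum_{i=1}^\infty d_iq^{-i}$; $(d_i)$ is called a $q$-expansion of $x$ if $x=\pi_q((d_i))$. For $q\in(1,M+1]$, $\mathcal{U}_q'$ denotes the set of sequences $(d_i)\in\{0,\ldots,M\}^\infty$ such that $(d_i)$ is the unique $q$-expansion (with digits in $\{0,\ldots,M\}$) of the number $\pi_q((d_i))$. $\mathcal{U}$ denotes the set of real numbers $q>1$ such that $1$ has a unique $q$-expansion with digits in $\{0,\ldots,M\}$ (so $\mathcal U\subseteq(1,M+1]$). $\dim_H$ denotes Hausdorff dimension in $\mathbb R$ with the Euclidean metric. *)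

(* Defs.v *)
From HB Require Import structures.
From mathcomp Require Import all_boot all_order all_algebra.
From mathcomp Require Import all_classical all_reals all_analysis.
Set Implicit Arguments.
Unset Strict Implicit.
Unset Printing Implicit Defensive.
Import Order.TTheory GRing.Theory Num.Theory.
Import numFieldNormedType.Exports.
Local Open Scope classical_set_scope.
Local Open Scope ring_scope.

Section Expansions.
Variables (R : realType) (M : nat).

(* A digit sequence over {0, ..., M}; indices are shifted by one, so [d i] is
   the digit d_(i+1), with weight q ^- (i + 1). *)
Definition digits := nat -> 'I_M.+1.

(* The limit exists for every q > 1, the only bases considered below. *)
Definition piq (q : R) (d : digits) : R :=
  limn (series (fun i => (d i)%:R * q ^- i.+1)).

Definition is_expansion (q x : R) (d : digits) : Prop := x = piq q d.

(* The set U'_q of univocal sequences in base q. *)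
Definition univocal_seqs (q : R) : set digits :=
  [set d | forall e : digits, is_expansion q (piq q d) e -> e = d].

(* The set U of univocal bases. *)
Definition univocal_bases : set R :=
  [set q | 1 < q /\ exists! d : digits, is_expansion q 1 d].

End Expansions.

Arguments univocal_seqs {R} M q.
Arguments univocal_bases R M : clear implicits.

Section Hausdorff.
Variable R : realType.
Local Open Scope ereal_scope.

(* [diam set0 = -oo], the supremum of the empty set in [\bar R]. *)
Definition diam (A : set R) : \bar R :=
  ereal_sup [set `|x.1 - x.2|%:E | x in A `*` A].

(* diam(A) ^ s, with value 0 for A = set0 (including at s = 0), whereas
   0 ^ 0 = 1 for a singleton. *)
Definition hausdorff_gauge (s : R) (A : set R) : \bar R :=
  if A == set0 then 0 else diam A `^ s.

Definition delta_covers (delta : R) (A : set R) : set (nat -> set R) :=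
  [set F | A `<=` \bigcup_i F i /\ forall i, diam (F i) <= delta%:E].

Definition hausdorff_premeasure (s delta : R) (A : set R) : \bar R :=
  ereal_inf [set \sum_(0 <= i <oo) hausdorff_gauge s (F i)
            | F in delta_covers delta A].

Definition hausdorff_measure (s : R) (A : set R) : \bar R :=
  ereal_sup [set hausdorff_premeasure s delta A
            | delta in [set delta : R | (0 < delta)%R]].

Definition hausdorff_dim (A : set R) : \bar R :=
  ereal_inf [set s%:E | s in
    [set s : R | (0 <= s)%R /\ hausdorff_measure s A = 0]].

End Hausdorff.

(* Main.v *)
Require Import Defs.
From HB Require Import structures.
From mathcomp Require Import all_boot all_order all_algebra.
From mathcomp Require Import all_classical all_reals all_analysis.
From mathcomp Require Import ring lra zify.
Set Implicit Arguments.
Unset Strict Implicit.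
Unset Printing Implicit Defensive.
Import Order.TTheory GRing.Theory Num.Theory.
Import numFieldNormedType.Exports.
Local Open Scope classical_set_scope.
Local Open Scope ring_scope.

(** Univocal sequences are characterized by values of tails: d is in U'_q iff,
    for d and for its reflection, every tail following a digit < M has value
    < 1 in base q.  Let a be the quasi-greedy expansion of 1 in base q, all of
    whose tails have values in (0, 1]; then q is in U iff a is in U'_q.

    If q is not in U, then for r slightly larger than q no tail following a
    digit < M in a sequence of U'_r exceeds a lexicographically.  Hence
    sequences of U'_r outside U'_q eventually coincide with a or its reflection,
    and there are only countably many of them; p |-> 0 d, where d is the
    expansion of 1 in base p, embeds U /\ (q, r) into this countable set.

    If q < M + 1 is in U, then all proper tails of a are strictly between the
    reflection of a and a.  There are arbitrarily long prefixes P of a no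
    suffix of which is the reflection of a prefix, and prefixes a_1 ... a_L no
    proper suffix of which is a prefix.  For two prefixes P, P' of the first
    kind and one of the second kind, all sequences
    a_1 ... a_(L-1) (a_L + 1) w_1 w_2 ..., where each w_i is either ~P P' or
    ~P' P (~ denoting reflection), have their proper tails strictly between
    their reflection and themselves, so that each of them is the unique
    expansion of 1 in a base of (q, r).  The free choice of the w_i gives
    positive dimension both to the set of these bases and to the set of
    sequences. *)

(** * Shifts and reflection of digit sequences *)

Definition sh M (n : nat) (d : digits M) : digits M := fun i => d (n + i)%N.
Definition refl M (d : digits M) : digits M := fun i => rev_ord (d i).

Lemma sh_sh M n m (d : digits M) : sh n (sh m d) = sh (m + n) d.
Proof. by apply/funext => i; rewrite /sh addnA. Qed.

Lemma reflK M (d : digits M) : refl (refl d) = d.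
Proof. by apply/funext => i; rewrite /refl rev_ordK. Qed.

(** * Estimates up to a geometric error *)

Section Geometric.
Variable R : realType.

Lemma expVn_lt (q : R) (e : R) : 1 < q -> 0 < e -> exists n : nat, q ^- n < e.
Proof.
move=> q1 e0.
have q0 : 0 < q by exact: lt_trans q1.
have : q^-1 ^+ n @[n --> \oo] --> (0 : R).
  by apply: cvg_expr; rewrite ger0_norm ?invr_ge0 ?ltW// invf_lt1.
move/cvgrPdist_lt => /(_ e e0) [N _ /(_ N (leqnn N))] /=.
rewrite sub0r normrN ger0_norm ?exprn_ge0 ?invr_ge0 ?ltW// exprVn => h.
by exists N.
Qed.

Lemma le_geom (q x y C : R) : 1 < q ->
  (forall n : nat, x <= y + q ^- n * C) -> x <= y.
Proof.
move=> q1 h; rewrite leNgt; apply/negP => yx.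
have C0 : 0 < C by have := h 0; rewrite expr0 invr1 mul1r; lra.
have xy : 0 < x - y by rewrite subr_gt0.
have [n] := expVn_lt q1 (divr_gt0 xy C0).
rewrite ltr_pdivlMr// => hn; have := h n; lra.
Qed.

End Geometric.

(** * Values of digit sequences and their dependence on the base *)

Section Expansions.
Variables (R : realType) (M : nat).
Implicit Types (d e a : digits M) (p q r : R).

Lemma digit_le d i : ((d i)%:R : R) <= M%:R.
Proof. by rewrite ler_nat -ltnS. Qed.

Lemma refl_digit d i : ((refl d i)%:R : R) = M%:R - (d i)%:R.
Proof. by rewrite /= subSS natrB// -ltnS. Qed.

Let part q d n := \sum_(0 <= i < n) (d i)%:R * q ^- i.+1.

Lemma part_le q d n : 1 < q -> part q d n <= M%:R / (q - 1) * (1 - q ^- n).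
Proof.
move=> q1; rewrite /part; elim: n => [|n IH].
  by rewrite big_geq// expr0 invr1 subrr mulr0.
rewrite big_nat_recr//=; apply: le_trans (lerD IH (_ : _ <= M%:R * q ^- n.+1)) _.
  by rewrite ler_wpM2r ?digit_le// invr_ge0 exprn_ge0//; lra.
rewrite exprS invfM; set t := q ^- n.
suff -> : M%:R / (q - 1) * (1 - t) + M%:R * (q^-1 * t) =
  M%:R / (q - 1) * (1 - q^-1 * t) by [].
by field; apply/andP; split; lra.
Qed.

Lemma piq_cvg q d : 1 < q -> cvgn (series (fun i => (d i)%:R * q ^- i.+1)).
Proof.
move=> q1; apply: nondecreasing_is_cvgn.
  apply/nondecreasing_seqP => n.
  rewrite /series /= big_nat_recr//= lerDl mulr_ge0// invr_ge0 exprn_ge0//; lra.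
exists (M%:R / (q - 1)) => _ [n _ <-].
apply: le_trans (part_le d n q1) _.
rewrite -[leRHS]mulr1 ler_wpM2l ?divr_ge0//; first lra.
by rewrite lerBlDr lerDl invr_ge0 exprn_ge0//; lra.
Qed.

Lemma piq_ge0 q d : 1 < q -> 0 <= piq q d.
Proof.
move=> q1; apply: limr_ge; first exact: piq_cvg.
apply: nearW => n; apply: sumr_ge0 => i _.
by rewrite mulr_ge0// invr_ge0 exprn_ge0//; lra.
Qed.

Lemma piq_le q d : 1 < q -> piq q d <= M%:R / (q - 1).
Proof.
move=> q1; apply: limr_le; first exact: piq_cvg.
apply: nearW => n; apply: le_trans (part_le d n q1) _.
rewrite -[leRHS]mulr1 ler_wpM2l ?divr_ge0//; first lra.
by rewrite lerBlDr lerDl invr_ge0 exprn_ge0//; lra.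
Qed.

Lemma piqS q d : 1 < q -> piq q d = ((d 0)%:R + piq q (sh 1 d)) / q.
Proof.
move=> q1; have q0 : q != 0 by lra.
have h1 : series (fun i => (d i)%:R * q ^- i.+1) n @[n --> \oo] --> piq q d.
  exact: piq_cvg.
rewrite -(cvg_shiftS _) in h1.
have h2 : ((d 0)%:R + series (fun i => (sh 1 d i)%:R * q ^- i.+1) n) / q
   @[n --> \oo] --> ((d 0)%:R + piq q (sh 1 d)) / q.
  by apply: cvgMr_tmp; apply: cvgD; [exact: cvg_cst|exact: piq_cvg].
suff E : (fun n => series (fun i => (d i)%:R * q ^- i.+1) n.+1) =
    (fun n => ((d 0)%:R + series (fun i => (sh 1 d i)%:R * q ^- i.+1) n) / q).
  by rewrite -(cvg_lim (@Rhausdorff R) h1) -(cvg_lim (@Rhausdorff R) h2) E.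
apply/funext => n; rewrite /series /= big_nat_recl//= mulrDl mulr_suml; congr (_ + _).
by apply: eq_bigr => i _; rewrite /sh add1n -mulrA -invfM -exprSr.
Qed.

Lemma piq_split q d n : 1 < q ->
  piq q d = \sum_(i < n) (d i)%:R * q ^- i.+1 + q ^- n * piq q (sh n d).
Proof.
move=> q1; have q0 : q != 0 by lra.
elim: n => [|n ->]; first by rewrite big_ord0 add0r expr0 invr1 mul1r.
rewrite big_ord_recr /= -addrA; congr (_ + _).
rewrite (piqS (sh n d))// sh_sh addn1 /sh addn0.
by rewrite exprSr; field; rewrite q0 expf_neq0.
Qed.

(** Unrolling the recurrence n times leaves the error q^-n x_n, which tends to 0 since x is
    bounded. *)
Lemma piq_rem q d (x : nat -> R) (C : R) : 1 < q ->
  (forall n, 0 <= x n <= C) -> (forall n, x n.+1 = q * x n - (d n)%:R) ->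
  piq q d = x 0.
Proof.
move=> q1 xC hx; have q0 : 0 < q by lra.
have key n : x 0 = \sum_(i < n) (d i)%:R * q ^- i.+1 + q ^- n * x n.
  elim: n => [|n ->]; first by rewrite big_ord0 add0r expr0 invr1 mul1r.
  rewrite big_ord_recr /= -addrA hx; congr (_ + _).
  by rewrite exprSr; field; rewrite expf_neq0//; lra.
have qn n : 0 <= q ^- n by rewrite invr_ge0 exprn_ge0// ltW.
apply/eqP; rewrite eq_le; apply/andP; split.
  apply: (@le_geom _ q _ _ (M%:R / (q - 1))) => // n.
  rewrite (piq_split d n)// [x 0](key n) -addrA lerD2l.
  have := ler_wpM2l (qn n) (piq_le (sh n d) q1).
  by have /andP[] := xC n => x0 _; have := mulr_ge0 (qn n) x0; lra.
apply: (@le_geom _ q _ _ C) => // n.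
rewrite (piq_split d n)// [x 0](key n) -addrA lerD2l.
have := mulr_ge0 (qn n) (piq_ge0 (sh n d) q1).
by have /andP[_] := xC n => /(ler_wpM2l (qn n)); lra.
Qed.

Lemma piq_refl q d : 1 < q -> piq q (refl d) = M%:R / (q - 1) - piq q d.
Proof.
move=> q1.
rewrite (piq_rem (x := fun n => M%:R / (q - 1) - piq q (sh n d))
  (C := M%:R / (q - 1)))// => n; first by rewrite subr_ge0 piq_le//= gerBl piq_ge0.
rewrite refl_digit [in RHS](piqS (sh n d))// sh_sh addn1 /sh addn0.
by field; apply/andP; split; lra.
Qed.

Lemma piq_mono q d e : 1 < q -> (forall i, (d i <= e i)%N) -> piq q d <= piq q e.
Proof.
move=> q1 de; apply: (@le_geom _ q _ _ (M%:R / (q - 1))) => // n.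
have qn m : 0 <= q ^- m by rewrite invr_ge0 exprn_ge0//; lra.
rewrite (piq_split d n)// (piq_split e n)//.
have : \sum_(i < n) (d i)%:R * q ^- i.+1 <= \sum_(i < n) (e i)%:R * q ^- i.+1.
  by apply: ler_sum => i _; rewrite ler_wpM2r// ler_nat.
have := ler_wpM2l (qn n) (piq_le (sh n d) q1).
by have := mulr_ge0 (qn n) (piq_ge0 (sh n e) q1); lra.
Qed.

Lemma piq_base q p d : 1 < q -> q <= p -> piq p d <= piq q d.
Proof.
move=> q1 qp; have p1 : 1 < p by lra.
apply: (@le_geom _ p _ _ (M%:R / (p - 1))) => // n.
have qn m : 0 <= q ^- m by rewrite invr_ge0 exprn_ge0//; lra.
have pn m : 0 <= p ^- m by rewrite invr_ge0 exprn_ge0//; lra.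
rewrite (piq_split (q := p) d n)// (piq_split (q := q) d n)//.
have : \sum_(i < n) (d i)%:R * p ^- i.+1 <= \sum_(i < n) (d i)%:R * q ^- i.+1.
  apply: ler_sum => i _; rewrite ler_wpM2l// lef_pV2 ?posrE ?exprn_gt0//; try lra.
  by rewrite ler_pXn2r ?nnegrE//; lra.
have := ler_wpM2l (pn n) (piq_le (sh n d) p1).
by have := mulr_ge0 (qn n) (piq_ge0 (sh n d) q1); lra.
Qed.

(** [piq_base] for the reflection bounds the loss by M/(q-1) - M/(p-1), uniformly in [d]. *)
Lemma piq_lip q p d : 1 < q -> q <= p ->
  piq q d - piq p d <= M%:R / (q - 1) ^+ 2 * (p - q).
Proof.
move=> q1 qp.
have := piq_base (refl d) q1 qp; rewrite !piq_refl//; last lra.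
suff : M%:R / (q - 1) - M%:R / (p - 1) <= M%:R / (q - 1) ^+ 2 * (p - q) by lra.
have -> : M%:R / (q - 1) - M%:R / (p - 1) =
    M%:R / ((q - 1) * (p - 1)) * (p - q).
  by field; apply/andP; split; lra.
rewrite ler_wpM2r ?subr_ge0// ler_wpM2l// lef_pV2 ?posrE; [|nra|nra].
by rewrite expr2; nra.
Qed.

Lemma piq_digit q d i : 1 < q -> (0 < d i)%N -> q ^- i.+1 <= piq q d.
Proof.
move=> q1 di; rewrite (piq_split d i.+1)// big_ord_recr /=.
have qn m : 0 <= q ^- m by rewrite invr_ge0 exprn_ge0//; lra.
have h1 : 0 <= \sum_(j < i) (d j)%:R * q ^- j.+1.
  by apply: sumr_ge0 => j _; rewrite mulr_ge0.
have h2 := mulr_ge0 (qn i.+1) (piq_ge0 (sh i.+1 d) q1).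
have h3 : 1 * q ^- i.+1 <= (d i)%:R * q ^- i.+1 by rewrite ler_wpM2r// ler1n.
lra.
Qed.

Lemma piq_eq0 q d : 1 < q -> piq q d <= 0 -> forall i, d i = ord0.
Proof.
move=> q1 d0 i; apply: val_inj => /=; have [//|di] := posnP (d i).
have := piq_digit q1 di; have : 0 < q ^- i.+1 by rewrite invr_gt0 exprn_gt0//; lra.
by move=> h1 h2; exfalso; lra.
Qed.

Lemma piq_base_lt q p d : 1 < q -> q < p -> 0 < piq p d -> piq p d < piq q d.
Proof.
move=> q1 qp dp.
have p1 : 1 < p by lra.
have := dp; rewrite (piqS d p1) (piqS (q := q) d)//.
have := piq_base (sh 1 d) q1 (ltW qp) => h h1.
have h2 : 0 < (d 0)%:R + piq p (sh 1 d).
  by move: h1; rewrite pmulr_lgt0// invr_gt0; lra.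
apply: (@lt_le_trans _ _ (((d 0)%:R + piq p (sh 1 d)) / q)).
  by rewrite ltr_pM2l// ltf_pV2 ?posrE; lra.
by rewrite ler_wpM2r ?lerD2l// invr_ge0; lra.
Qed.

End Expansions.

(** * Lexicographic order on digit sequences *)

Section Lexicographic.
Variable M : nat.
Implicit Types d e f : digits M.

Definition agree n d e := forall i, (i < n)%N -> d i = e i.

Definition lexlt d e := exists2 n, agree n d e & (d n < e n)%N.

Lemma agree_sym n d e : agree n d e -> agree n e d.
Proof. by move=> h i /h. Qed.

Lemma agree_first_difference d e : d <> e -> exists2 n, agree n d e & d n <> e n.
Proof.
move=> de; have : exists n, d n != e n.
  apply: contrapT => h; apply: de; apply/funext => n.
  by apply/eqP/negPn/negP => hn; apply: h; exists n.
move=> ex; case: (ex_minnP ex) => n /eqP hn hmin; exists n => // i lt_in.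
by apply/eqP; apply: contraTT lt_in => /hmin; rewrite -leqNgt.
Qed.

Lemma lexlt_total d e : [\/ lexlt d e, d = e | lexlt e d].
Proof.
have [->|/agree_first_difference[n h hn]] := pselect (d = e); first exact: Or32.
have : (d n < e n)%N || (e n < d n)%N.
  by rewrite -neq_ltn; apply/eqP => h'; apply: hn; apply: val_inj.
by case/orP => lt_n; [apply: Or31|apply: Or33]; exists n => //; exact: agree_sym.
Qed.

Lemma lexlt_trans d e f : lexlt d e -> lexlt e f -> lexlt d f.
Proof.
move=> [n hn ltn] [m hm ltm]; have [nm|mn|E] := ltngtP n m.
- exists n; last by rewrite -hm.
  by move=> i lt_in; rewrite hn// hm// (ltn_trans lt_in).
- exists m; last by rewrite hn.
  by move=> i lt_im; rewrite hn ?hm// (ltn_trans lt_im).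
- exists n; first by move=> i lt_in; rewrite hn ?hm// -E.
  by rewrite (ltn_trans ltn)// E.
Qed.

Lemma lexlt_irr d : ~ lexlt d d.
Proof. by move=> [n _]; rewrite ltnn. Qed.

Lemma lexlt_refl d e : lexlt (refl d) (refl e) <-> lexlt e d.
Proof.
suff h d' e' : lexlt e' d' -> lexlt (refl d') (refl e').
  by split => /h //; rewrite !reflK.
move=> [n hn ltn]; exists n; first by move=> i /hn h; rewrite /refl h.
rewrite /refl /= !subSS; apply: ltn_sub2l => //.
by apply: leq_trans ltn _; rewrite -ltnS.
Qed.

Lemma refl_lt d i : (refl d i < M)%N = (0 < d i)%N.
Proof. by rewrite /refl /=; have := ltn_ord (d i); lia. Qed.

End Lexicographic.

(** * Univocal sequences and quasi-greedy expansions *)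

Section Univocal.
Variables (R : realType) (M : nat).
Implicit Types (d e a : digits M) (p q r : R).

Lemma piq_agree q d e n : 1 < q -> agree n d e ->
  piq q d - piq q e = q ^- n.+1 * ((d n)%:R - (e n)%:R
                        + piq q (sh n.+1 d) - piq q (sh n.+1 e)).
Proof.
move=> q1 de; have q0 : q != 0 by lra.
rewrite (piq_split d n)// (piq_split e n)//.
rewrite (eq_bigr (fun i : 'I_n => (e i)%:R * q ^- i.+1)); last first.
  by move=> i _; rewrite de.
rewrite (piqS (sh n d))// (piqS (sh n e))// !sh_sh !addn1 /sh !addn0.
by rewrite exprSr; field; rewrite q0 expf_neq0.
Qed.

Lemma expV_gt0 q n : 1 < q -> 0 < q ^- n.
Proof. by move=> q1; rewrite invr_gt0 exprn_gt0//; lra. Qed.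

Lemma lexlt_piq q a d : 1 < q -> (forall k, piq q (sh k a) <= 1) ->
  lexlt a d -> piq q a <= piq q d.
Proof.
move=> q1 a1 [n ad lt_n]; rewrite -subr_ge0 (piq_agree q1 (agree_sym ad)).
apply: mulr_ge0; first exact/ltW/expV_gt0.
have : (a n)%:R + 1 <= (d n)%:R :> R by rewrite natr1 ler_nat.
have := a1 n.+1; have := piq_ge0 (sh n.+1 d) q1; lra.
Qed.

Lemma lexlt_piq_lt q a d : 1 < q -> (forall k, piq q (sh k a) <= 1) ->
  (forall k, 0 < piq q (sh k d)) -> lexlt a d -> piq q a < piq q d.
Proof.
move=> q1 a1 d0 [n ad lt_n]; rewrite -subr_gt0 (piq_agree q1 (agree_sym ad)).
apply: mulr_gt0; first exact: expV_gt0.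
have : (a n)%:R + 1 <= (d n)%:R :> R by rewrite natr1 ler_nat.
have := a1 n.+1; have := d0 n.+1; lra.
Qed.

(** Such a tail leaves no room for raising the preceding digit; for the reflection, the condition
    forbids lowering it. *)
Definition tails_lt1 q d := forall n, (d n < M)%N -> piq q (sh n.+1 d) < 1.

(* A sequence bounded lexicographically by [a] after each digit [< M] has all
   these tails of value [< 1]: an excess over [1] would be multiplied by at
   least [q] each time one follows the tail past the first difference with
   [a]. *)
Lemma lexlt_tails_lt1 q a d : 1 < q -> piq q a <= 1 ->
  (forall k, 0 < piq q (sh k a)) ->
  (forall n, (d n < M)%N -> lexlt (sh n.+1 d) a) -> tails_lt1 q d.
Proof.
move=> q1 a1 a0 da; pose C := M%:R / (q - 1) : R.
have C0 : 0 <= C by rewrite divr_ge0//; lra.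
have step n (dn : (d n < M)%N) : exists m k, [/\ (d m < M)%N &
    piq q (sh n.+1 d) <= 1 - q ^- k.+1 * (piq q (sh k.+1 a) + 1
                                       - piq q (sh m.+1 d))].
  have [k hk lt_k] := da n dn; exists (n.+1 + k)%N, k; split.
    by rewrite (leq_trans lt_k)// -ltnS.
  have := piq_agree q1 hk; rewrite sh_sh addnS.
  have := expV_gt0 k.+1 q1.
  have : (sh n.+1 d k)%:R + 1 <= (a k)%:R :> R by rewrite natr1 ler_nat.
  move: (q ^- k.+1) (piq q (sh k.+1 a)) (piq q _) (_%:R) (_%:R) => *; nra.
have main N n : (d n < M)%N -> piq q (sh n.+1 d) <= 1 + q ^- N * C.
  elim: N n => [|N IH] n dn.
    by rewrite expr0 invr1 mul1r (le_trans (piq_le _ q1))// /C; lra.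
  have [m [k [dm h]]] := step n dn; apply: le_trans h _.
  have := IH m dm; have := a0 k.+1.
  have := expV_gt0 k.+1 q1; have := expV_gt0 N q1; have := expV_gt0 N.+1 q1.
  have : q ^- k.+1 * q ^- N <= q ^- N.+1.
    rewrite -invfM -exprD lef_pV2 ?posrE ?exprn_gt0//; try lra.
    rewrite ler_weXn2l//; first exact: ltW.
    by rewrite addSn ltnS leq_addl.
  move: (q ^- k.+1) (q ^- N) (q ^- N.+1) (piq q _) (piq q _) => x y z v u.
  move=> h1 h2 h3 h4 h5 h6; have : x * (v - 1 - u) <= x * (y * C) by rewrite ler_wpM2l//; lra.
  have : x * y * C <= z * C by rewrite ler_wpM2r.
  lra.
have main1 n : (d n < M)%N -> piq q (sh n.+1 d) <= 1.
  by move=> dn; apply: (le_geom (C := C) q1) => N; exact: main.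
move=> n dn; have [m [k [dm h]]] := step n dn; apply: le_lt_trans h _.
rewrite gtrBl mulr_gt0 ?expV_gt0//.
have := main1 m dm; have := a0 k.+1; lra.
Qed.

(** [P] is an invariant of a digit algorithm: iterating the choice of digits keeps all remainders,
    which are the values of the tails, in [P]. *)
Lemma expansion_exists q (P : R -> Prop) (C : R) : 1 < q ->
  (forall x, P x -> 0 <= x <= C) ->
  (forall x, P x -> exists c : 'I_M.+1, P (q * x - c%:R)) ->
  forall x, P x -> exists2 d : digits M, piq q d = x & forall n, P (piq q (sh n d)).
Proof.
move=> q1 PC Pstep.
have /choice[f hf] : forall x, exists c : 'I_M.+1, P x -> P (q * x - c%:R).
  move=> x; have [/Pstep[c Pc]|nPx] := pselect (P x); first by exists c.
  by exists ord0 => /nPx.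
move=> x Px; pose X n := iter n (fun y => q * y - (f y)%:R) x.
have PX n : P (X n) by elim: n => //= n; exact: hf.
have piX n : piq q (sh n (fun i => f (X i))) = X n.
  rewrite (@piq_rem _ _ q _ (fun k => X (n + k)%N) C)// ?addn0// => k.
    exact/PC/PX.
  by rewrite addnS.
exists (fun i => f (X i)); first exact: (piX 0).
by move=> n; rewrite piX.
Qed.

Lemma all_expansions q x : 1 < q <= M.+1%:R -> 0 <= x <= M%:R / (q - 1) ->
  exists d : digits M, piq q d = x.
Proof.
move=> /andP[q1 qM] hx; have MC : 1 <= M%:R / (q - 1).
  by rewrite ler_pdivlMr ?mul1r; move: qM; rewrite -natr1; lra.
have [//||d <- _] := @expansion_exists q
  (fun x => 0 <= x <= M%:R / (q - 1)) (M%:R / (q - 1)) q1 _ _ x hx; last by exists d.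
move=> y /andP[y0 yC].
have ex : exists n : nat, q * y - n%:R <= M%:R / (q - 1).
  exists M; have := ler_wpM2l (_ : 0 <= q) yC => /(_ ltac:(lra)).
  suff -> : q * (M%:R / (q - 1)) = M%:R / (q - 1) + M%:R by lra.
  by field; lra.
(* Lazy choice: the least admissible digit. If it is positive, the next smaller digit leaves more
   than M/(q-1) >= 1, so the remainder is nonnegative. *)
case: (ex_minnP ex) => c hc cmin.
have cM : (c < M.+1)%N.
  rewrite ltnS; apply: cmin; have := ler_wpM2l (_ : 0 <= q) yC => /(_ ltac:(lra)).
  suff -> : q * (M%:R / (q - 1)) = M%:R / (q - 1) + M%:R by lra.
  by field; lra.
exists (Ordinal cM); rewrite /= hc andbT.
case: c hc cmin cM => [|c] hc cmin cM; first by rewrite subr0 mulr_ge0//; lra.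
have : ~~ (q * y - c%:R <= M%:R / (q - 1)).
  by apply/negP => /cmin; rewrite ltnn.
by rewrite -ltNge -natr1; lra.
Qed.

(** Positive tails exclude expansions ending in zeros; with the upper bound 1 this characterizes the
    quasi-greedy expansion of 1 by its remainders. *)
Definition quasi_greedy q a :=
  piq q a = 1 /\ forall n, 0 < piq q (sh n a) <= 1.

Lemma quasi_greedy_exists q : 1 < q <= M.+1%:R -> exists a, quasi_greedy q a.
Proof.
move=> /andP[q1 qM].
have [| | |a ? ?] := @expansion_exists q (fun x => 0 < x <= 1) 1 q1 _ _ 1.
- by move=> x /andP[/ltW -> ->].
- move=> y /andP[y0 y1].
  have qy : q * y <= M.+1%:R by nra.
  have ex : exists n : nat, q * y <= n.+1%:R by exists M.
  case: (ex_minnP ex) => c hc cmin; have cM : (c < M.+1)%N by rewrite ltnS cmin.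
  exists (Ordinal cM) => /=; move: hc; rewrite -natr1 => hc.
  apply/andP; split; last lra.
  case: c hc cmin cM => [|c] hc cmin cM; first by rewrite subr0 mulr_gt0//; lra.
  have : ~~ (q * y <= c.+1%:R) by apply/negP => /cmin; rewrite ltnn.
  by rewrite -ltNge; lra.
- by rewrite ltr01 lexx.
- by exists a.
Qed.

Lemma univocal_refl q d : 1 < q ->
  univocal_seqs M q d -> univocal_seqs M q (refl d).
Proof.
move=> q1 ud e; rewrite /is_expansion piq_refl// => h.
by rewrite -(reflK e) (ud (refl e))// /is_expansion piq_refl// -h opprB addrC subrK.
Qed.

(** At the first difference with another expansion of the same number, a larger digit forces the
    tail of [d] to have value at least 1; a smaller digit forces this for the reflection. *)
Lemma tails_lt1_univocal q d : 1 < q ->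
  tails_lt1 q d -> tails_lt1 q (refl d) -> univocal_seqs M q d.
Proof.
move=> q1 td tr e; rewrite /is_expansion => de; apply: contrapT => ned.
have [n hn nen] := agree_first_difference ned.
have hp := piq_agree q1 hn; rewrite de subrr in hp.
have hp' : (e n)%:R - (d n)%:R + piq q (sh n.+1 e) - piq q (sh n.+1 d) = 0.
  have := expV_gt0 n.+1 q1; move/eqP: hp; rewrite eq_sym mulf_eq0.
  by case/orP => /eqP //; lra.
have : (d n < e n)%N || (e n < d n)%N.
  by rewrite -neq_ltn; apply/eqP => h; apply: nen; apply: val_inj.
case/orP => lt_n.
  have := td n (leq_trans lt_n (_ : (e n <= M)%N)); rewrite -ltnS => /(_ (ltn_ord _)).
  have : (d n)%:R + 1 <= (e n)%:R :> R by rewrite natr1 ler_nat.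
  have := piq_ge0 (sh n.+1 e) q1; lra.
have : (refl d n < M)%N by rewrite refl_lt (leq_ltn_trans _ lt_n).
move/tr; rewrite piq_refl//.
have : (e n)%:R + 1 <= (d n)%:R :> R by rewrite natr1 ler_nat.
have := piq_le (sh n.+1 e) q1; lra.
Qed.

Lemma univocal_tails_lt1 q d : 1 < q <= M.+1%:R ->
  univocal_seqs M q d -> tails_lt1 q d.
Proof.
move=> q1M ud n dn; have /andP[q1 qM] := q1M.
rewrite ltNge; apply/negP => h.
(* A tail of value at least 1 allows raising [d n] by one and expanding the value of the tail minus
   1. *)
have [|e he] := all_expansions (x := piq q (sh n.+1 d) - 1) q1M.
  by have := piq_le (sh n.+1 d) q1; lra.
pose d' : digits M := fun i => if (i < n)%N then d i
  else if i == n then inord (d n).+1 else e (i - n.+1)%N.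
have d'e : sh n.+1 d' = e.
  apply/funext => i; rewrite /sh /d' /=.
  rewrite ltnNge (leq_trans (leqnSn n) (leq_addr i n.+1)) /= gtn_eqF ?leq_addr//.
  by rewrite addKn.
have ag : agree n d' d by move=> i lt_in; rewrite /d' lt_in.
have d'n : d' n = (d n).+1 :> nat by rewrite /d' ltnn eqxx inordK.
have E : piq q d' = piq q d.
  apply/eqP; rewrite -subr_eq0 (piq_agree q1 ag) d'e he d'n -natr1.
  by rewrite [X in _ * X](_ : _ = 0) ?mulr0//; ring.
have := ud d' (esym E) => d'd; move: d'n; rewrite d'd.
by move/n_Sn.
Qed.

Lemma univocalP q d : 1 < q <= M.+1%:R ->
  univocal_seqs M q d <-> tails_lt1 q d /\ tails_lt1 q (refl d).
Proof.
move=> q1M; have /andP[q1 qM] := q1M; split => [ud|[]].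
  by split; apply: univocal_tails_lt1 => //; exact: univocal_refl.
exact: tails_lt1_univocal.
Qed.

Lemma tails_lt1_base q r d : 1 < q -> q <= r -> tails_lt1 q d -> tails_lt1 r d.
Proof. by move=> q1 qr h n /h; apply: le_lt_trans; exact: piq_base. Qed.

End Univocal.

(** * Countable gaps above bases that are not univocal *)

Section Gap.
Variables (R : realType) (M : nat).
Implicit Types (d e a : digits M) (p q r : R).

Lemma quasi_greedy_bounds q a : quasi_greedy q a -> forall k, piq q (sh k a) <= 1.
Proof. by move=> [_ h] k; case/andP: (h k). Qed.

Lemma quasi_greedy_gt0 q a : quasi_greedy q a -> forall k, 0 < piq q (sh k a).
Proof. by move=> [_ h] k; case/andP: (h k). Qed.

Lemma quasi_greedy_inj q a b : 1 < q ->
  quasi_greedy q a -> quasi_greedy q b -> a = b.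
Proof.
move=> q1 qa qb; have [h||h] := lexlt_total a b => //.
  have := lexlt_piq_lt q1 (quasi_greedy_bounds qa) (quasi_greedy_gt0 qb) h.
  by rewrite qa.1 qb.1 ltxx.
have := lexlt_piq_lt q1 (quasi_greedy_bounds qb) (quasi_greedy_gt0 qa) h.
by rewrite qa.1 qb.1 ltxx.
Qed.

Lemma quasi_greedy_sh q a m : quasi_greedy q a -> piq q (sh m a) = 1 ->
  quasi_greedy q (sh m a).
Proof. by move=> [_ h] h1; split=> // n; rewrite sh_sh. Qed.

Lemma univocal_basesP q a : 1 < q -> quasi_greedy q a ->
  univocal_bases R M q <-> univocal_seqs M q a.
Proof.
move=> q1 qa; split=> [[_ [d [_ ud]]]|ua].
  move=> e; rewrite /is_expansion qa.1 => he.
  by rewrite -(ud e he) (ud a)// /is_expansion qa.1.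
split=> //; exists a; split; first by rewrite /is_expansion qa.1.
by move=> e he; apply/esym/ua; rewrite /is_expansion qa.1.
Qed.

Lemma univocal_bases_top : (1 <= M)%N -> univocal_bases R M M.+1%:R.
Proof.
move=> M1; have q1 : 1 < M.+1%:R :> R by rewrite ltr1n.
have E : M%:R / (M.+1%:R - 1) = 1 :> R.
  by rewrite -natr1 addrK divff// pnatr_eq0; case: M M1.
pose z : digits M := fun=> ord0.
have z0 : piq (M.+1%:R : R) z = 0.
  by rewrite (@piq_rem _ _ _ _ (fun=> 0) 0)//= => n; rewrite ?lexx// mulr0 subr0.
split=> //; exists (refl z); split; first by rewrite /is_expansion piq_refl// z0 E subr0.
move=> e; rewrite /is_expansion => he.
have /(piq_eq0 q1) h : piq (M.+1%:R : R) (refl e) <= 0 by rewrite piq_refl// -he E subrr.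
by rewrite -(reflK e); congr (refl _); apply/funext => i; rewrite h.
Qed.

Lemma piq_lower_semicontinuous q d (c : R) : 1 < q -> c < piq q d ->
  exists2 r0, q < r0 & forall r, q < r < r0 -> c < piq r d.
Proof.
move=> q1 cd; pose K := M%:R / (q - 1) ^+ 2 : R.
have K0 : 0 <= K by rewrite divr_ge0// exprn_ge0//; lra.
have t0 : 0 < (piq q d - c) / (K + 1) by rewrite divr_gt0//; lra.
exists (q + (piq q d - c) / (K + 1)); first lra.
move=> r /andP[qr rr]; have := piq_lip d q1 (ltW qr); rewrite -/K => h.
have : (r - q) * (K + 1) < piq q d - c by rewrite -ltr_pdivlMr; lra.
nra.
Qed.

(** When [a j] < [M], this is the lexicographically least sequence that exceeds [a] first at
    position [j]; otherwise [inord] falls back to 0. *)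
Definition bump_trunc j a : digits M := fun i =>
  if (i < j)%N then a i else if i == j then inord (a j).+1 else ord0.

Lemma piq_ord0 q : 1 < q -> piq q (fun=> ord0 : 'I_M.+1) = 0.
Proof.
move=> q1; rewrite (@piq_rem _ _ _ _ (fun=> 0) 0)//= => n; first by rewrite lexx.
by rewrite mulr0 subr0.
Qed.

Lemma piq_gt0 q p d : 1 < q -> 1 < p -> 0 < piq q d -> 0 < piq p d.
Proof.
move=> q1 p1; apply: contraTT; rewrite -!leNgt => /(piq_eq0 p1) d0.
by rewrite (_ : d = fun=> ord0) ?piq_ord0//; apply/funext => i; exact: d0.
Qed.

Lemma agree_bump_trunc j a : agree j (bump_trunc j a) a.
Proof. by move=> i lt_ij; rewrite /bump_trunc lt_ij. Qed.

Lemma bump_trunc_digit j a : (a j < M)%N -> bump_trunc j a j = (a j).+1 :> nat.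
Proof. by move=> h; rewrite /bump_trunc ltnn eqxx inordK. Qed.

Lemma piq_bump_tail q j a : 1 < q -> piq q (sh j.+1 (bump_trunc j a)) = 0.
Proof.
move=> q1; rewrite -[RHS](piq_ord0 q1); congr piq; apply/funext => i.
rewrite /sh /bump_trunc ltnNge (leq_trans (leqnSn j) (leq_addr i j.+1)) /=.
by rewrite gtn_eqF ?leq_addr.
Qed.

Lemma piq_bump_trunc q j a : 1 < q -> (a j < M)%N ->
  piq q (bump_trunc j a) = piq q a + q ^- j.+1 * (1 - piq q (sh j.+1 a)).
Proof.
move=> q1 aj; have := piq_agree q1 (@agree_bump_trunc j a).
rewrite piq_bump_tail// bump_trunc_digit// -natr1 => h.
by apply: (addIr (- piq q a)); rewrite h; ring.
Qed.

Lemma piq_ge_bump_trunc q j a f : 1 < q -> agree j a f -> (a j < f j)%N ->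
  piq q (bump_trunc j a) + q ^- j.+1 * piq q (sh j.+1 f) <= piq q f.
Proof.
move=> q1 af lt_j; have aj : (a j < M)%N by rewrite (leq_trans lt_j)// -ltnS.
have := piq_agree (d := f) (e := bump_trunc j a) q1.
have ag : agree j f (bump_trunc j a) by move=> i h; rewrite agree_bump_trunc// af.
move=> /(_ _ ag); rewrite piq_bump_tail// bump_trunc_digit//.
have : (a j).+1%:R <= (f j)%:R :> R by rewrite ler_nat.
by have := expV_gt0 j.+1 q1; nra.
Qed.

(** A sequence exceeding [a] first at [j] has at least the value of [bump_trunc j a]. This is above
    1 in base q, because the tail of [a] after [j] is below 1, and so it is in slightly larger
    bases; finitely many [j] share one [r0]. *)
Lemma near_prefix q a N : 1 < q -> piq q a = 1 ->
  (forall j, (j < N)%N -> piq q (sh j.+1 a) < 1) ->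
  exists2 r0, q < r0 & forall r f j, q < r < r0 -> piq r f < 1 ->
    (j < N)%N -> agree j a f -> ~ (a j < f j)%N.
Proof.
move=> q1 a1; elim: N => [|N IH] hN; first by exists (q + 1) => //; lra.
have [r0 qr0 h0] := IH (fun j h => hN j (leqW h)).
have [aM|aM] := ltnP (a N) M; last first.
  exists r0 => // r f j hr f1; rewrite ltnS leq_eqVlt => /predU1P[->|].
    by move=> _ ltN; have := ltn_ord (f N); rewrite ltnS leqNgt (leq_ltn_trans aM ltN).
  exact: (h0 r f j hr f1).
have : 1 < piq q (bump_trunc N a).
  rewrite piq_bump_trunc// a1 ltrDl mulr_gt0 ?expV_gt0// subr_gt0.
  exact: hN.
move/(piq_lower_semicontinuous q1) => [r1 qr1 h1].
exists (Num.min r0 r1); first by rewrite lt_min qr0.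
move=> r f j /andP[qr]; rewrite lt_min => /andP[rr0 rr1] f1.
rewrite ltnS leq_eqVlt => /predU1P[->|lt_j]; last by apply: (h0 r f j) => //; rewrite qr.
move=> af ltN; have r1' : 1 < r by lra.
have := piq_ge_bump_trunc r1' af ltN.
have := mulr_ge0 (ltW (expV_gt0 N.+1 r1')) (piq_ge0 (sh N.+1 f) r1').
by have := h1 r; rewrite qr rr1 => /(_ isT); lra.
Qed.

(* If [1] has periodic quasi-greedy expansion [a], of period [m.+1], a tail
   of a sequence univocal in base [r] can only leave [a] upwards at the end of
   a period; it then continues with a value at least [M / (r - 1) - 1 > 0],
   which makes the value of the whole tail exceed [1]. *)
Lemma gap_periodic q a m : 1 < q < M.+1%:R -> quasi_greedy q a ->
  (forall j, (j < m)%N -> piq q (sh j.+1 a) < 1) -> piq q (sh m.+1 a) = 1 ->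
  exists2 r0, q < r0 & forall r d k, q < r < r0 -> tails_lt1 r d ->
    tails_lt1 r (refl d) -> (d k < M)%N -> ~ lexlt a (sh k.+1 d).
Proof.
move=> /andP[q1 qM] qa hm am.
have per : sh m.+1 a = a by apply: (quasi_greedy_inj q1 _ qa); exact: quasi_greedy_sh.
have aM : (a m < M)%N.
  rewrite ltnNge; apply/negP => Ma.
  have := quasi_greedy_bounds qa m; rewrite (piqS (sh m a))// sh_sh addn1 am.
  rewrite /sh addn0 ler_pdivrMr ?mul1r; last lra.
  have : M%:R <= (a m)%:R :> R by rewrite ler_nat.
  by move: qM; rewrite -natr1; lra.
have [r0 qr0 h0] := near_prefix q1 qa.1 hm.
(* Staying below [r1] < M + 1 makes M/(r-1) - 1 at least [eta] > 0 uniformly in r. *)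
pose r1 := (q + M.+1%:R) / 2; have [qr1 r1M] : q < r1 /\ r1 < M.+1%:R by rewrite /r1; lra.
pose eta := M%:R / (r1 - 1) - 1.
have eta0 : 0 < eta.
  by rewrite subr_gt0 ltr_pdivlMr ?mul1r; move: r1M; rewrite -natr1; lra.
have r11 : 1 < r1 by lra.
pose c := r1 ^- m.+1 * eta.
have c0 : 0 < c by rewrite mulr_gt0// expV_gt0.
have : 1 - c < piq q (bump_trunc m a).
  by rewrite piq_bump_trunc// am subrr mulr0 qa.1; lra.
move/(piq_lower_semicontinuous q1) => [r2 qr2 h2].
exists (Num.min r0 (Num.min r1 r2)); first by rewrite !lt_min qr0 qr1.
move=> r d k /andP[qr]; rewrite !lt_min => /and3P[rr0 rr1 rr2] td tr.
have r1' : 1 < r by lra.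
move=> + [j]; elim/ltn_ind: j k => j IH k dk aj lt_j.
have [jm|mj|E] := ltngtP j m.
- by apply: (h0 r (sh k.+1 d) j) => //; [rewrite qr|exact: td].
(* The tail completes a period before leaving [a]: restart the comparison after that period, whose
   last digit [a m] is below [M]. *)
- pose k' := (k.+1 + m)%N; have dk' : d k' = a m by rewrite aj.
  apply: (IH (j - m.+1)%N _ k').
  + by rewrite ltn_subrL /=; apply: leq_ltn_trans mj.
  + by rewrite dk'.
  + move=> i hi; rewrite -{1}per /sh aj; last by rewrite -ltn_subRL.
    by rewrite /sh /k' addSn addnA addnS addSn.
  + have := congr1 (fun f => f (j - m.+1)%N) per; rewrite /sh subnKC// => <-.
    suff <- : d (k.+1 + j)%N = d (k'.+1 + (j - m.+1))%N by [].
    by rewrite /k' -addnS -addnA subnKC.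
- subst j; have f1 := td k dk.
  have := piq_ge_bump_trunc r1' aj lt_j; rewrite sh_sh.
  have : (refl d (k.+1 + m) < M)%N by rewrite refl_lt; apply: leq_ltn_trans lt_j.
  move/tr; rewrite piq_refl// addnS => h.
  have hw : 1 - c < piq r (bump_trunc m a) by apply: h2; rewrite qr.
  have : c <= r ^- m.+1 * piq r (sh (k.+1 + m).+1 d).
    apply: ler_pM; [exact/ltW/expV_gt0|exact/ltW| |].
      rewrite lef_pV2 ?posrE ?exprn_gt0//; try lra.
      by rewrite ler_pXn2r ?nnegrE//; lra.
    apply: le_trans (_ : M%:R / (r - 1) - 1 <= _); last lra.
    rewrite lerD2r ler_wpM2l// lef_pV2 ?posrE; lra.
  lra.
Qed.

(** An early excess over [a] is ruled out by [near_prefix]. Before a late one, the tail copies so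
    many digits of [a] that the reflected tail after position [n] starts with a word of value above
    1. *)
Lemma gap_aperiodic q a n : 1 < q < M.+1%:R -> quasi_greedy q a ->
  (forall j, piq q (sh j.+1 a) < 1) -> (0 < a n)%N ->
  1 < piq q (sh n.+1 (refl a)) ->
  exists2 r0, q < r0 & forall r d k, q < r < r0 -> tails_lt1 r d ->
    tails_lt1 r (refl d) -> (d k < M)%N -> ~ lexlt a (sh k.+1 d).
Proof.
move=> /andP[q1 qM] qa h1 an hn.
set b := sh n.+1 (refl a) in hn.
pose w N : digits M := fun i => if (i < N)%N then b i else ord0.
have [N hN] : exists N, 1 < piq q (w N).
  apply: contrapT => hno.
  suff : piq q b <= 1 by lra.
  apply: (le_geom (C := M%:R / (q - 1)) q1) => N.
  have : piq q (w N) <= 1 by rewrite leNgt; apply/negP => h; apply: hno; exists N.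
  rewrite (piq_split b N)// (piq_split (w N) N)//.
  rewrite (eq_bigr (fun i : 'I_N => (b i)%:R * q ^- i.+1)); last first.
    by move=> i _; rewrite /w ltn_ord.
  have qn := expV_gt0 N q1.
  have := mulr_ge0 (ltW qn) (piq_ge0 (sh N (w N)) q1).
  have := ler_wpM2l (ltW qn) (piq_le (sh N b) q1).
  lra.
have [r0 qr0 h0] := @near_prefix q a (n.+1 + N) q1 qa.1 (fun j _ => h1 j).
have [r1 qr1 h2] := piq_lower_semicontinuous q1 hN.
exists (Num.min r0 r1); first by rewrite lt_min qr0.
move=> r d k /andP[qr]; rewrite lt_min => /andP[rr0 rr1] td tr dk [j aj lt_j].
have r1' : 1 < r by lra.
have [jN|Nj] := ltnP j (n.+1 + N).
  by apply: (h0 r (sh k.+1 d) j) => //; [rewrite qr|exact: td].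
have an' : d (k.+1 + n)%N = a n.
  by rewrite aj//; apply: leq_trans Nj; rewrite ltn_addr.
have : (refl d (k.+1 + n) < M)%N by rewrite refl_lt an'.
move/tr; apply/negP; rewrite -leNgt.
have : 1 < piq r (w N) by apply: h2; rewrite qr.
move/ltW/le_trans; apply; apply: piq_mono => // i.
rewrite /w; case: ifP => // iN; rewrite /b /sh /refl aj.
  by rewrite /sh addnA addnS.
by apply: leq_trans Nj; rewrite ltn_add2l.
Qed.

Lemma not_univocal_gap q a : 1 < q < M.+1%:R -> quasi_greedy q a ->
  ~ univocal_seqs M q a ->
  exists2 r0, q < r0 & forall r d k, q < r < r0 -> tails_lt1 r d ->
    tails_lt1 r (refl d) -> (d k < M)%N -> ~ lexlt a (sh k.+1 d).
Proof.
move=> q1M qa nua; have /andP[q1 qM] := q1M.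
have a1 := quasi_greedy_bounds qa; have a0 := quasi_greedy_gt0 qa.
have [ex|nex] := pselect (exists m, piq q (sh m.+1 a) == 1).
  case: (ex_minnP ex) => m /eqP hm mmin; apply: gap_periodic q1M qa _ hm => j jm.
  rewrite lt_neqAle a1 andbT; apply/negP => /mmin.
  by rewrite leqNgt jm.
have lt1 j : piq q (sh j.+1 a) < 1.
  by rewrite lt_neqAle a1 andbT; apply/negP => h; apply: nex; exists j.
(* All proper tails of [a] are now below 1, so univocality fails on the reflected side. *)
have [n an nlt] : exists2 n, (0 < a n)%N & ~ lexlt (sh n.+1 (refl a)) a.
  apply: contrapT => hno; apply: nua; apply: tails_lt1_univocal => //.
  apply: (lexlt_tails_lt1 q1 _ a0); rewrite ?qa.1// => n.
  by rewrite refl_lt => h; apply: contrapT => h'; apply: hno; exists n.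
apply: (gap_aperiodic q1M qa lt1 an).
have [//|E|] := lexlt_total (sh n.+1 (refl a)) a.
  (* If shifting by n + 1 reflects [a], doing it twice restores [a], so that a proper tail would
     have value 1. *)
  have : sh (n.+1 + n.+1) a = a.
    have E1 : sh n.+1 a = refl a.
      by rewrite -{2}E -[sh n.+1 (refl a)]/(refl (sh n.+1 a)) reflK.
    by rewrite -sh_sh E1.
  by move=> E2; have := lt1 (n.+1 + n)%N; rewrite -addnS E2 qa.1 ltxx.
move/(lexlt_piq_lt q1 a1); rewrite qa.1; apply => k.
rewrite sh_sh (_ : sh _ (refl a) = refl (sh (n.+1 + k) a))// piq_refl// subr_gt0.
apply: le_lt_trans (a1 _) _; rewrite ltr_pdivlMr ?mul1r; last lra.
by move: qM; rewrite -natr1; lra.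
Qed.

Definition catd (w : seq 'I_M.+1) d : digits M :=
  fun i => if (i < size w)%N then nth ord0 w i else d (i - size w)%N.

Lemma catd_take k d : catd (mkseq d k) (sh k d) = d.
Proof.
apply/funext => i; rewrite /catd size_mkseq; case: ltnP => h.
  by rewrite nth_mkseq.
by rewrite /sh subnKC.
Qed.

Lemma sh_cons d : sh 1 (catd [:: ord0] d) = d.
Proof. by apply/funext => i; rewrite /sh /catd /= subn1. Qed.

Lemma countable_tail a b : countable [set d | exists k, sh k d = a \/ sh k d = b].
Proof.
apply: (sub_countable (B := [set: seq 'I_M.+1 * bool])); last exact: countableP.
apply: card_le_trans (card_image_le (fun w => catd w.1 (if w.2 then a else b)) setT).
apply: subset_card_le => d [k [] <-].
  by exists (mkseq d k, true); rewrite //= catd_take.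
by exists (mkseq d k, false); rewrite //= catd_take.
Qed.

Lemma countable_gap q : 1 < q < M.+1%:R -> ~ univocal_bases R M q ->
  exists2 r, q < r < M.+1%:R & countable (univocal_seqs M r `\` univocal_seqs M q).
Proof.
move=> q1M nU; have /andP[q1 qM] := q1M.
have [a qa] : exists a : digits M, quasi_greedy q a.
  by apply: quasi_greedy_exists; rewrite q1 ltW.
have [|r0 qr0 h0] := not_univocal_gap q1M qa.
  by move=> /(univocal_basesP q1 qa).
pose r1 := Num.min r0 M.+1%:R; have qr1 : q < r1 by rewrite lt_min qr0.
pose r := (q + r1) / 2; have [qr rr1] : q < r /\ r < r1 by rewrite /r; lra.
move: rr1; rewrite /r1 lt_min => /andP[rr0 rM]; exists r; first by rewrite qr.
have r1' : 1 < r by lra.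
apply: (sub_countable _ (countable_tail a (refl a))).
apply: subset_card_le => d [/(univocalP _ (_ : _))[] ]; first by rewrite r1' ltW.
move=> td tr nud; apply: contrapT => hno; apply: nud.
have key e : tails_lt1 r e -> tails_lt1 r (refl e) ->
    (forall k, sh k e <> a) -> tails_lt1 q e.
  move=> te tre hk; apply: (lexlt_tails_lt1 q1 _ (quasi_greedy_gt0 qa)).
    by rewrite qa.1.
  move=> n en; have [//|E|h] := lexlt_total (sh n.+1 e) a; first by case: (hk n.+1).
  by case: (h0 r e n) => //; rewrite qr.
apply: tails_lt1_univocal => //; apply: key; rewrite ?reflK// => k hk; apply: hno.
  by exists k; left.
by exists k; right; rewrite -hk reflK.
Qed.

(** The leading 0 turns the value of [d] into a tail condition: it is below 1 in base r > p, but at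
    least 1 in base q < p. *)
Lemma univocal_bases_seq q p r : (0 < M)%N -> 1 < q -> q < p < r -> r <= M.+1%:R ->
  forall d, piq p d = 1 -> univocal_seqs M p d ->
  (univocal_seqs M r `\` univocal_seqs M q) (catd [:: ord0] d).
Proof.
move=> M0 q1 /andP[qp pr] rM d d1 ud.
have p1 : 1 < p by lra.
have shd := sh_cons d.
have E n e : sh n.+2 (catd [:: ord0] e) = sh n.+1 e.
  by apply/funext => i; rewrite /sh /catd /= subn1.
have Er n e : sh n.+2 (refl (catd [:: ord0] e)) = sh n.+1 (refl e).
  by apply/funext => i; rewrite /sh /refl /catd /= subn1.
have pM : 1 < p <= M.+1%:R by apply/andP; split; lra.
have [td tr] := (univocalP d pM).1 ud.
split.
  apply: tails_lt1_univocal; first lra.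
    case=> [|n].
      move=> _; rewrite shd -d1; apply: piq_base_lt => //.
      by apply: (piq_gt0 p1); rewrite ?d1//; lra.
    rewrite E /catd /= subn1 => /td; apply: le_lt_trans.
    by apply: piq_base => //; exact: ltW.
  case=> [|n]; first by rewrite /refl /catd /= subn1 ltnn.
  rewrite Er /refl /catd /= subn1 => /tr; apply: le_lt_trans.
  by apply: piq_base => //; exact: ltW.
move=> /(univocal_tails_lt1 _)-/(_ _ 0%N).
rewrite shd => h; have : piq q d < 1 by apply: h => //; rewrite q1; lra.
by have := piq_base d q1 (ltW qp); rewrite d1; lra.
Qed.

End Gap.

(** * Bounds for the Hausdorff dimension *)

Section HausdorffDimension.
Variable R : realType.

Lemma hausdorff_gauge_ge0 (s : R) (A : set R) : (0 <= hausdorff_gauge s A)%E.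
Proof. by rewrite /hausdorff_gauge; case: ifP => // _; exact: poweR_ge0. Qed.

Lemma diam_ge (A : set R) x y : A x -> A y -> (`|x - y|%:E <= diam A)%E.
Proof. by move=> Ax Ay; apply: ereal_sup_ubound; exists (x, y). Qed.

(** The fibers of an injection into the naturals cover [A] by sets of at most one point, whose gauge
    vanishes for every s > 0. *)
Lemma hausdorff_dim_countable (A : set R) :
  countable A -> (hausdorff_dim A <= 0)%E.
Proof.
move=> /countable_injP[f finj].
apply/lee_addgt0Pr => s s0; rewrite add0e.
apply: ereal_inf_lbound; exists s => //; split; first exact: ltW.
pose F n := [set x | A x /\ f x = n].
have F1 n x y : F n x -> F n y -> x = y.
  by move=> [Ax fx] [Ay fy]; apply: finj; rewrite ?inE// fx fy.
have dF n : (diam (F n) <= 0)%E.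
  by apply: ge_ereal_sup => _ [[x y] [/= Fx Fy] <-]; rewrite (F1 _ _ _ Fx Fy) subrr normr0.
have pre delta : 0 < delta -> hausdorff_premeasure s delta A = 0%E.
  move=> d0; apply/eqP; rewrite eq_le; apply/andP; split; last first.
    by apply/ereal_infP => _ [G _ <-]; apply: nneseries_ge0 => i _ _; exact: hausdorff_gauge_ge0.
  apply: ge_ereal_inf; exists 0%E => //; exists F.
    split; first by move=> x Ax; exists (f x).
    by move=> i; apply: le_trans (dF i) _; rewrite lee_fin ltW.
  apply: eseries0 => i _ _; rewrite /hausdorff_gauge; case: ifPn => // /set0P[x Fx].
  suff -> : diam (F i) = 0%E by rewrite poweR0r// gt_eqF.
  apply/eqP; rewrite eq_le dF /=.
  by have := diam_ge Fx Fx; rewrite subrr normr0.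
apply/eqP; rewrite eq_le; apply/andP; split.
  by apply: ge_ereal_sup => _ [delta d0 <-]; rewrite pre.
by apply: le_ereal_sup_tmp; exists 0%E => //; exists 1; [exact: ltr01|exact/pre/ltr01].
Qed.

Lemma powR_le1_antitone (u s t : R) : 0 < u <= 1 -> t <= s -> u `^ s <= u `^ t.
Proof.
move=> /andP[u0 u1] ts; rewrite /powR gt_eqF// ler_expR.
by rewrite ler_wnM2r// ln_le0.
Qed.

Lemma interval_measure (y z : R) : 0 <= z ->
  lebesgue_measure `[y - z, y + z] = (2 * z)%:E.
Proof.
move=> z0; rewrite lebesgue_measure_itv /= lte_fin; case: ifPn => h.
  by rewrite -EFinD; congr EFin; ring.
by congr EFin; move: h; rewrite -leNgt; lra.
Qed.

Lemma binary_max : 1%:R / (2 - 1) = 1 :> R.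
Proof. by rewrite -[2]/(1 + 1)%:R natrD addrK divr1. Qed.

Lemma binary_agree (s t : digits 1) k : agree k s t ->
  `|piq (2 : R) s - piq 2 t| <= 2 ^- k.
Proof.
move=> st; have h : (1 : R) < 2 by lra.
rewrite (piq_split s k)// (piq_split t k)//.
rewrite (eq_bigr (fun i : 'I_k => (t i)%:R * 2 ^- i.+1)); last first.
  by move=> i _; rewrite st.
rewrite opprD addrACA subrr add0r -mulrBr normrM ger0_norm; last by apply: ltW; apply: expV_gt0; lra.
apply: ler_piMr; first by apply: ltW; apply: expV_gt0; lra.
have := piq_ge0 (sh k s) h; have := piq_ge0 (sh k t) h.
have := piq_le (sh k s) h; have := piq_le (sh k t) h.
rewrite binary_max.
by rewrite ler_norml => *; apply/andP; split; lra.
Qed.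

(* If x is a parametrization of points of A by binary sequences, sending
   sequences that first differ at k to points at distance at least c rho^k, then
   x s |-> sum_i s_i 2^-(i+1) is Hoelder continuous and maps onto [0,1], so
   that [0,1] is covered by intervals of lengths comparable to the gauges of
   any cover of A. *)
Lemma hausdorff_dim_gt0 (A : set R) (x : digits 1 -> R) (c rho : R) :
  0 < c -> 0 < rho < 1 -> (forall s, A (x s)) ->
  (forall s t k, agree k s t -> s k <> t k -> c * rho ^+ k <= `|x s - x t|) ->
  (0 < hausdorff_dim A)%E.
Proof.
move=> c0 /andP[rho0 rho1] Ax sep.
have lnrho : ln rho < 0 by rewrite ln_lt0// rho0.
(* [s0] solves rho^s0 = 1/2, so a separation of order rho^k matches the binary scale 2^-k. *)
pose s0 : R := ln 2 / - ln rho.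
have s00 : 0 < s0 by rewrite divr_gt0 ?oppr_gt0// ln_gt0// ltr1n.
have rhos k : (rho ^+ k) `^ s0 = 2 ^- k.
  rewrite -powR_mulrn ?ltW// -powRrM mulrC powRrM.
  rewrite (_ : rho `^ s0 = 2^-1) ?powR_mulrn ?exprVn// /powR gt_eqF//.
  rewrite (_ : s0 * ln rho = - ln 2); last by rewrite /s0; field; lra.
  by rewrite expRN lnK// posrE.
pose K := c^-1 `^ s0; have K0 : 0 < K by apply: powR_gt0; rewrite invr_gt0.
have holder s t u e : 0 <= e <= s0 -> `|x s - x t| <= u -> u <= 1 ->
    `|piq (2 : R) s - piq 2 t| <= K * u `^ e.
  move=> /andP[e0 es0] xu u1; have [->|/agree_first_difference[k hk hn]] := pselect (s = t).
    by rewrite subrr normr0 mulr_ge0 ?powR_ge0// ltW.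
  apply: le_trans (binary_agree hk) _; have hs := sep s t k hk hn.
  have u0 : 0 < u by apply: lt_le_trans xu; apply: lt_le_trans hs; rewrite mulr_gt0 ?exprn_gt0.
  apply: (@le_trans _ _ (K * u `^ s0)); last first.
    apply: ler_wpM2l; first exact: ltW.
    by apply: powR_le1_antitone; rewrite ?u0.
  rewrite /K -powRM; [|by rewrite invr_ge0 ltW|exact: ltW].
  rewrite -rhos; apply: ge0_ler_powR.
  - exact: ltW.
  - by rewrite nnegrE exprn_ge0// ltW.
  - by rewrite nnegrE mulr_ge0 ?invr_ge0 ?(ltW c0)// ltW.
  - by rewrite mulrC ler_pdivlMr// mulrC; apply: le_trans hs xu.
apply: (@lt_le_trans _ _ s0%:E); first by rewrite lte_fin.
apply/ereal_infP => _ [e [e0 He] <-]; rewrite lee_fin leNgt; apply/negP => es0.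
have : (hausdorff_premeasure e 1 A <= 0)%E.
  by rewrite -He; apply: ereal_sup_ubound; exists 1 => /=.
(* Intervals of length 2K times the gauges will cover [0, 1], so the gauges of a cover sum to at
   least 1/(2K). *)
apply/negP; rewrite -ltNge; apply: (@lt_le_trans _ _ (2 * K)^-1%:E).
  by rewrite lte_fin invr_gt0 mulr_gt0.
apply/ereal_infP => _ [F [FA Fd] <-].
have /choice[sel hsel] : forall i, exists s, (exists s', F i (x s')) -> F i (x s).
  move=> i; have [[s Fs]|nF] := pselect (exists s', F i (x s')); first by exists s.
  by exists (fun=> ord0) => /nF.
pose D i := fine (hausdorff_gauge e (F i)).
have gaugeE i : hausdorff_gauge e (F i) = (D i)%:E.
  rewrite /D /hausdorff_gauge; case: ifPn => // /set0P[y Fy].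
  have d0 : (0 <= diam (F i))%E by apply: le_trans (diam_ge Fy Fy); rewrite lee_fin.
  have := Fd i; case: (diam (F i)) d0 => [v| |]//= _ _; by rewrite poweR_EFin.
have D0 i : 0 <= D i by rewrite -lee_fin -gaugeE hausdorff_gauge_ge0.
have gaugeD i s t : F i (x s) -> F i (x t) ->
    `|piq (2 : R) s - piq 2 t| <= K * D i.
  move=> Fs Ft; have := Fd i; have := gaugeE i; have := diam_ge Fs Ft.
  rewrite /hausdorff_gauge ifF; last by apply/negbTE/set0P; exists (x s).
  case: (diam (F i)) => [v| |]//=; rewrite !lee_fin => xv [<-] v1.
  by apply: holder => //; rewrite e0 ltW.
pose I i := [set` `[piq 2 (sel i) - K * D i, piq 2 (sel i) + K * D i]].
have cov : [set` `[0 : R, 1]] `<=` \bigcup_i I i.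
  move=> y /=; rewrite in_itv /= => y01.
  have [s hs] : exists s : digits 1, piq 2 s = y.
    by apply: all_expansions; [lra|rewrite binary_max].
  have [i _ Fi] := FA _ (Ax s); exists i => //; rewrite /I /= in_itv /= -hs.
  have : F i (x (sel i)) by apply: hsel; exists s.
  by move/(gaugeD i _ _ Fi); rewrite ler_norml; lra.
have h : (1%:E <= \sum_(0 <= i <oo) lebesgue_measure (I i))%E.
  have <- : lebesgue_measure [set` `[0 : R, 1]] = 1%:E :> \bar R.
    by rewrite lebesgue_measure_itv /= lte_fin ltr01 sube0.
  apply: (measure_sigma_subadditive (@lebesgue_measure R)) => //.
  by move=> i; exact: measurable_itv.
rewrite -(@lee_pmul2l _ (2 * K)%:E)//; last by rewrite lte_fin mulr_gt0.
rewrite -EFinM mulfV; last by rewrite gt_eqF// mulr_gt0.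
rewrite -nneseriesZl; last by move=> i _; exact: hausdorff_gauge_ge0.
apply: le_trans h _; apply: lee_nneseries => i // _.
rewrite interval_measure ?(mulr_ge0 (ltW K0))// gaugeE -EFinM lee_fin.
by rewrite mulrA.
Qed.

End HausdorffDimension.

(** * Combinatorial construction of admissible sequences above [a] *)

Section AdmissibleFamily.
Variable M : nat.
Implicit Types a c d e h : digits M.

Definition prefix_le L d e :=
  forall k, (k < L)%N -> agree k d e -> (d k <= e k)%N.

Lemma lexlt_prefix_le L d e : lexlt d e -> prefix_le L d e.
Proof.
move=> [n hn lt_n] k _ hk; have [kn|nk|E] := ltngtP k n; last by rewrite E ltnW.
  by rewrite hn.
by move: lt_n; rewrite hk// ltnn.
Qed.

(** A weak comparison of prefixes suffices, because [d] is strictly above [a] at position [L]. *)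
Lemma prefix_le_lexlt L a h d : prefix_le L.+1 h a -> agree L a d ->
  (a L < d L)%N -> lexlt h d.
Proof.
move=> ha ad lt_L; have [->|/agree_first_difference[k hk hn]] := pselect (h = a).
  by exists L.
have [kL|Lk] := ltnP k L.
  exists k; first by move=> i ik; rewrite hk// ad// (ltn_trans ik).
  rewrite -ad// ltn_neqAle ha ?ltnS 1?ltnW// andbT.
  by apply/eqP => h'; apply: hn; apply: val_inj.
have hL : agree L h a by move=> i iL; rewrite hk// (leq_trans iL).
exists L; first by move=> i iL; rewrite hL// ad.
by apply: leq_ltn_trans lt_L; apply: ha.
Qed.

(* The position following a longest match of a tail of [c] with a prefix of
   [a] cannot be covered by a match starting later, since [a] would then have
   a tail larger than [a]. *)
Lemma unmatched_positions c a j0 N : (forall j, (j0 <= j)%N -> lexlt (sh j c) a) ->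
  (forall n, ~ lexlt a (sh n a)) ->
  exists2 m, (N < m)%N & forall j, (j0 <= j < m)%N -> ~ agree (m - j) (sh j c) a.
Proof.
move=> ca aa.
have [|hN] := pselect (forall j, (j0 <= j < N.+1)%N -> ~ agree (N.+1 - j) (sh j c) a).
  by exists N.+1.
have ex : exists j, (j0 <= j < N.+1)%N && `[< agree (N.+1 - j) (sh j c) a >].
  apply: contrapT => h; apply: hN => j hj hag; apply: h; exists j.
  by rewrite hj; apply/asboolP.
case: (ex_minnP ex) => j /andP[/andP[j0j jN] /asboolP hj] jmin.
have [k hk lt_k] := ca j j0j.
have Nk : (N.+1 - j <= k)%N.
  by rewrite leqNgt; apply/negP => h; move: lt_k; rewrite hj// ltnn.
exists (j + k).+1; first lia.
move=> i /andP[j0i im] hi.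
have [ij|ji|E] := ltngtP i j.
- have : (j <= i)%N; last by rewrite leqNgt ij.
  apply: jmin; rewrite j0i (ltn_trans ij jN) /=; apply/asboolP => x hx.
  by apply: hi; lia.
- apply: (aa (i - j)%N); exists (k - (i - j))%N.
    move=> x hx; rewrite -hi; last lia.
    by rewrite /sh -hk /sh; [congr (c _)|]; lia.
  rewrite /sh subnKC; last lia.
  rewrite -hi; last lia.
  by apply: leq_ltn_trans lt_k; rewrite /sh (_ : i + _ = j + k)%N//; lia.
- by subst i; move: lt_k; rewrite hi ?ltnn//; lia.
Qed.

Section Construction.
Variable a : digits M.
Hypothesis a_up : forall n, lexlt (sh n.+1 a) a.
Hypothesis a_lo : forall n, lexlt (refl (sh n.+1 a)) a.

Let a_lo_strict n : lexlt (refl a) (sh n.+1 a).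
Proof. by apply/lexlt_refl; rewrite reflK. Qed.

Let a_lo0 n : lexlt (refl (sh n a)) a.
Proof. by case: n => [|n]; [exact: lexlt_trans (a_lo_strict 0) _|]. Qed.

Let a_up0 n L : prefix_le L (sh n a) a.
Proof. by case: n => [|n]; [move=> k|exact: lexlt_prefix_le]. Qed.

Let a_gt0 : (0 < a 0)%N.
Proof.
have h : (refl a 0 <= a 0)%N by exact: (lexlt_prefix_le (a_lo0 0) (ltnSn 0)).
have [k _] := a_lo0 0; rewrite ltnNge => hk.
have M0 : (0 < M)%N.
  rewrite lt0n; apply/eqP => M0; move: hk.
  by rewrite (leq_trans _ (leq0n _))// -ltnS /sh; have := ltn_ord (a k); lia.
by move: h; rewrite /refl /=; lia.
Qed.

(* Indices start at 0: [lam] is the position of the digit to be increased, so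
   the prefix of [a] without border has length [lam.+1]. *)
Variables n1 n2 lam : nat.
Hypothesis lam_gt0 : (0 < lam)%N.
Hypothesis lam_n1 : (lam.+1 < n1)%N.
Hypothesis n1_n2 : (n1 < n2)%N.
Hypothesis unmatched_lam : forall j, (1 <= j < lam.+1)%N ->
  ~ agree (lam.+1 - j) (sh j a) a.
Hypothesis unmatched_n1 : forall j, (0 <= j < n1)%N -> ~ agree (n1 - j) (sh j (refl a)) a.
Hypothesis unmatched_n2 : forall j, (0 <= j < n2)%N -> ~ agree (n2 - j) (sh j (refl a)) a.

(** If this digit equalled the first digit of [a], the prefix would have a border of length one;
    hence it is smaller. *)
Let a_lam : (a lam < M)%N.
Proof.
have h : (a lam <= a 0)%N.
  by have := a_up0 (ltnSn 0) (n := lam); rewrite /sh addn0; apply.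
apply: (@leq_trans (a 0)); last by rewrite -ltnS.
rewrite ltn_neqAle h andbT; apply/eqP => h'; apply: (unmatched_lam (j := lam)); first lia.
move=> i; rewrite subSnn ltnS leqn0 => /eqP ->.
by apply: val_inj; rewrite /sh addn0.
Qed.

Definition block_size (s : digits 1) k := if s k == ord0 then n1 else n2.

(** Block [k] is a reflected prefix of [a] of length [n1] or [n2], followed by the prefix of the
    other length; thus all blocks have the same length. *)
Definition blocks (s : digits 1) : digits M := fun i =>
  let b := block_size s (i %/ (n1 + n2)) in let o := (i %% (n1 + n2))%N in
  if (o < b)%N then refl a o else a (o - b)%N.

Lemma blocksE s k o : (o < n1 + n2)%N -> blocks s (k * (n1 + n2) + o)%N =
  if (o < block_size s k)%N then refl a o else a (o - block_size s k)%N.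
Proof.
move=> h; rewrite /blocks divnMDl ?divn_small ?addn0//; last lia.
by rewrite modnMDl modn_small.
Qed.

Lemma block_sizeP s k : block_size s k = n1 \/ block_size s k = n2.
Proof. by rewrite /block_size; case: ifP; [left|right]. Qed.

Lemma unmatched_first_block s k j : (0 <= j < block_size s k)%N ->
  ~ agree (block_size s k - j) (sh j (refl a)) a.
Proof. by case: (block_sizeP s k) => ->; [exact: unmatched_n1|exact: unmatched_n2]. Qed.

Lemma unmatched_second_block s k j : (0 <= j < n1 + n2 - block_size s k)%N ->
  ~ agree (n1 + n2 - block_size s k - j) (sh j (refl a)) a.
Proof.
by case: (block_sizeP s k) => ->; [rewrite addKn; exact: unmatched_n2|rewrite addnK; exact: unmatched_n1].
Qed.

(** Here [h] is the end, from [j] on, of the prefix of length [m], followed by the start of the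
    reflection of [a]. As this end is no reflected prefix, the reflected comparison is decided
    within it. In the other comparison, a full match leaves the reflection of [a] against a proper
    tail of [a], which is larger. *)
Lemma block_pair h j m L : (j < m)%N ->
  (forall j, (0 <= j < m)%N -> ~ agree (m - j) (sh j (refl a)) a) ->
  (forall k, (k < m - j)%N -> h k = a (j + k)%N) ->
  (forall k, (k < L)%N -> h (m - j + k)%N = refl a k) ->
  prefix_le L h a /\ prefix_le L (refl h) a.
Proof.
move=> jm unmatched h1 h2; split; last first.
  apply: lexlt_prefix_le; have [k hk lt_k] := a_lo0 j.
  have kj : (k < m - j)%N.
    rewrite ltnNge; apply/negP => jk; apply: (unmatched j jm) => i ij.
    exact/hk/(leq_trans ij)/jk.
  exists k; last by rewrite /refl h1.
  by move=> i ik; rewrite -hk// /refl h1//; exact: ltn_trans kj.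
move=> k kL hk; have [kj|jk] := ltnP k (m - j).
  rewrite h1//; apply: (a_up0 (n := j) kL) => i ik.
  by rewrite /sh -h1 ?hk//; exact: ltn_trans kj.
have [k' E] : exists k', k = (m - j + k')%N by exists (k - (m - j))%N; rewrite subnKC.
subst k; rewrite h2; last lia.
have : exists n, (m - j)%N = n.+1 by exists (m - j).-1; lia.
move=> [n En]; rewrite En in hk *.
apply: (lexlt_prefix_le (a_lo_strict n) (ltnSn k')) => i ik.
by rewrite /sh -hk ?ltn_add2l// -En h2//; lia.
Qed.

(** Each half of a block is followed by a prefix of the opposite kind, longer than [lam] + 1, so
    [block_pair] applies, after a reflection if the start is in a first half. *)
Lemma blocks_prefix_le s i : prefix_le lam.+1 (sh i (blocks s)) a /\
  prefix_le lam.+1 (refl (sh i (blocks s))) a.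
Proof.
pose l := (n1 + n2)%N; have l0 : (0 < l)%N by rewrite /l; lia.
have [k [ o [lt_ol ->]]] : exists k o, (o < l)%N /\ i = (k * l + o)%N.
  by exists (i %/ l)%N, (i %% l)%N; rewrite -divn_eq ltn_mod.
set h := sh _ _; have bs := block_sizeP s k; set b := block_size s k in bs.
have hE x : (o + x < l)%N -> h x = if (o + x < b)%N then refl a (o + x)%N else a (o + x - b)%N.
  by move=> hx; rewrite /h /sh -addnA blocksE.
have [ob|bo] := ltnP o b.
  have [h1 h2] : prefix_le lam.+1 (refl h) a /\ prefix_le lam.+1 (refl (refl h)) a.
    apply: (block_pair ob) => [|x xb|x xL]; first exact: unmatched_first_block.
      by rewrite /refl hE ?ifT ?rev_ordK//; [lia|rewrite /l; lia].
    rewrite /refl hE; last by rewrite /l; lia.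
    rewrite ifF; last lia.
    by congr (rev_ord (a _)); lia.
  by rewrite reflK in h2.
have ob : (o - b < l - b)%N by lia.
apply: (block_pair ob) => [|x xb|x xL]; first exact: unmatched_second_block.
  by rewrite hE; [rewrite ifF; [congr (a _)|]|]; lia.
rewrite /h /sh (_ : _ + _ = k.+1 * l + x)%N; last by rewrite mulSn; lia.
by rewrite blocksE ?ifT//; have := block_sizeP s k.+1; lia.
Qed.

Definition family (s : digits 1) : digits M := fun i =>
  if (i < lam)%N then a i else if i == lam then inord (a lam).+1
  else blocks s (i - lam.+1)%N.

Lemma family_lt s : agree lam a (family s).
Proof. by move=> i h; rewrite /family h. Qed.

Lemma family_lam s : family s lam = (a lam).+1 :> nat.
Proof. by rewrite /family ltnn eqxx inordK. Qed.

Lemma family_gt s k : family s (lam.+1 + k)%N = blocks s k.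
Proof.
rewrite /family ltnNge (leq_trans (leqnSn lam) (leq_addr k lam.+1)) /=.
by rewrite gtn_eqF ?leq_addr// addKn.
Qed.

Lemma lexlt_family s : lexlt a (family s).
Proof. by exists lam; [exact: family_lt|rewrite family_lam]. Qed.

Lemma blocks0 s k : (k < n1)%N -> blocks s k = refl a k.
Proof.
move=> kn; have := @blocksE s 0 k; rewrite mul0n add0n => ->; last lia.
by rewrite ifT//; have := block_sizeP s 0; lia.
Qed.

Lemma sh_family_blocks s i : (lam < i)%N ->
  sh i (family s) = sh (i - lam.+1) (blocks s).
Proof.
move=> h; apply/funext => x; rewrite /sh -family_gt; congr (family s _); lia.
Qed.

(** A tail starting inside the prefix would, before raising, drop below [a] by position [lam], since
    the prefix has no border. Should the raised digit restore equality, the blocks go on with the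
    reflection of [a], which is below every proper tail of [a]. *)
Lemma family_up s n : lexlt (sh n.+1 (family s)) (family s).
Proof.
have lt_lam : (a lam < family s lam)%N by rewrite family_lam.
have [ni|ni] := ltnP lam n.+1.
  apply: prefix_le_lexlt (family_lt s) lt_lam.
  by rewrite sh_family_blocks//; case: (blocks_prefix_le s (n.+1 - lam.+1)).
pose y := (lam - n.+1)%N; have yE : (n.+1 + y = lam)%N by rewrite /y; lia.
have shE x : (x < y)%N -> sh n.+1 (family s) x = a (n.+1 + x)%N.
  by move=> xy; rewrite /sh -family_lt//; lia.
have [x hx lt_x] := a_up n.
have xy : (x <= y)%N.
  rewrite leqNgt; apply/negP => h; apply: (unmatched_lam (j := n.+1)); first lia.
  by move=> i hi; apply: hx; lia.
have agy k : (k <= x)%N -> agree k (sh n.+1 (family s)) (family s).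
  move=> kx i ik; rewrite shE; last lia.
  by rewrite -family_lt; [apply: hx|]; lia.
have [xy'|yx] := ltnP x y.
  by exists x; [exact: agy|rewrite shE// -family_lt//; lia].
have {xy yx} E : x = y by lia.
subst x.
have shy : sh n.+1 (family s) y = (a lam).+1 :> nat by rewrite /sh yE family_lam.
have fy : family s y = a y by rewrite -family_lt//; lia.
have lt_y : (a lam < a y)%N by move: lt_x; rewrite /sh yE.
have [lt_y'|le_y] := ltnP (a lam).+1 (a y).
  by exists y; [exact: agy|rewrite shy fy].
have ey : sh n.+1 (family s) y = family s y by apply: val_inj => /=; rewrite shy fy; lia.
have tailE k : (k < n1)%N -> sh n.+1 (family s) (y.+1 + k)%N = refl a k.
  move=> kn; rewrite -(blocks0 s kn) -family_gt /sh; congr (family s _); lia.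
have agyk k : (k <= n1)%N -> agree k (refl a) (sh y.+1 (family s)) ->
    agree (y.+1 + k) (sh n.+1 (family s)) (family s).
  move=> kn hk i ik; have [iy|yi|->] := ltngtP i y; last exact: ey.
    by apply: (agy y) => //.
  have -> : i = (y.+1 + (i - y.+1))%N by lia.
  by rewrite tailE; [rewrite hk//|]; lia.
have [z hz lt_z] := a_lo_strict y.
have fE k : (k < n)%N -> sh y.+1 (family s) k = sh y.+1 a k.
  by move=> kn; rewrite /sh -family_lt//; lia.
have [zn|nz] := ltnP z n.
  exists (y.+1 + z)%N.
    apply: agyk; first lia.
    by move=> i iz; rewrite fE ?hz// (ltn_trans iz).
  by rewrite tailE; [rewrite -[family s _]/(sh y.+1 _ _) fE|lia].
(* No difference before position [lam] of the right-hand side: its raised digit decides. *)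
exists (y.+1 + n)%N.
  apply: agyk; first lia.
  by move=> i iz; rewrite fE ?hz// (leq_trans iz).
rewrite tailE; last lia.
rewrite (_ : (y.+1 + n)%N = lam) ?family_lam ?ltnS; last lia.
have := lexlt_prefix_le (a_lo_strict y) (ltnSn n); rewrite /sh (_ : (y.+1 + n)%N = lam); last lia.
by apply => i iz; rewrite hz// (leq_trans iz).
Qed.

(** Inside the prefix, raising the digit at [lam] lowers the reflected tail, so the bound for [a]
    becomes strict there at the latest. *)
Lemma family_lo s n : lexlt (sh n.+1 (refl (family s))) (family s).
Proof.
have lt_lam : (a lam < family s lam)%N by rewrite family_lam.
have [ni|ni] := ltnP lam n.+1.
  apply: prefix_le_lexlt (family_lt s) lt_lam.
  rewrite -[sh _ _]/(refl (sh n.+1 (family s))) sh_family_blocks//.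
  by case: (blocks_prefix_le s (n.+1 - lam.+1)).
pose y := (lam - n.+1)%N; have yE : (n.+1 + y = lam)%N by rewrite /y; lia.
have shE x : (x < y)%N -> sh n.+1 (refl (family s)) x = refl a (n.+1 + x)%N.
  by move=> xy; rewrite /sh /refl -family_lt//; lia.
have [x hx lt_x] := a_lo n.
have fE x' : (x' <= y)%N -> family s x' = a x' by move=> xy; rewrite -family_lt//; lia.
have [xy|yx] := ltnP x y.
  exists x; last by rewrite shE// fE// ltnW.
  by move=> i ix; rewrite shE ?fE -?hx// ?(ltn_trans ix)// ltnW// (ltn_trans ix).
have ag : agree y (refl (sh n.+1 a)) a by move=> i iy; rewrite hx// (leq_trans iy).
exists y; first by move=> i iy; rewrite shE// fE ?(ltnW iy)// -ag.
rewrite fE//; apply: leq_trans (lexlt_prefix_le (a_lo n) (ltnSn y) ag).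
rewrite /sh /refl yE /= family_lam; have := a_lam; lia.
Qed.

(** If the k-th blocks agreed, their digits from offset [n1] on would make a suffix of the prefix of
    length [n2] a reflected prefix. *)
Lemma family_inj s t k : s k <> t k ->
  ~ agree (lam.+1 + k.+1 * (n1 + n2)) (family s) (family t).
Proof.
move=> st hag.
have key s' t' : agree (lam.+1 + k.+1 * (n1 + n2)) (family s') (family t') ->
    block_size s' k = n1 -> block_size t' k = n2 -> False.
  move=> h bs bt; apply: (unmatched_n2 (j := n1)); first lia.
  move=> o ho; have := h (lam.+1 + (k * (n1 + n2) + (n1 + o)))%N.
  rewrite !family_gt !blocksE; try lia.
  rewrite bs bt addKn ifF; last lia.
  rewrite ifT; last lia.
  by move=> E; rewrite /sh E//; rewrite mulSn; lia.
have [E|E] : s k == ord0 /\ t k <> ord0 \/ s k <> ord0 /\ t k == ord0.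
  case: (eqVneq (s k) ord0) => [E|/eqP E]; first by left; split=> // E'; apply: st; rewrite E E'.
  right; split=> //; apply/eqP/val_inj => /=.
  have : nat_of_ord (s k) <> nat_of_ord (t k) by move/val_inj.
  have : nat_of_ord (s k) <> 0%N by move=> h; apply: E; apply: val_inj.
  by have := ltn_ord (s k); have := ltn_ord (t k); lia.
- by apply: (key s t) => //; rewrite /block_size; [rewrite E.1|case: eqP => // /E.2].
- apply: (key t s); first exact: agree_sym.
    by rewrite /block_size E.2.
  by rewrite /block_size; case: eqP => // /E.1.
Qed.

(** Second halves start with [a 0] > 0, so runs of zeros are bounded; this bounds tails from below
    in the separation estimate. *)
Lemma family_gt0 s n : exists2 i, (i <= lam + 2 * (n1 + n2))%N & (0 < family s (n + i))%N.
Proof.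
have [nl|ln] := leqP n lam.
  exists (lam - n)%N; first lia.
  by rewrite subnKC// family_lam.
pose l := (n1 + n2)%N; have l0 : (0 < l)%N by rewrite /l; lia.
pose k := ((n - lam.+1) %/ l)%N.
have := divn_eq (n - lam.+1) l; have := ltn_pmod (n - lam.+1) l0; rewrite -/k.
move: (_ %% l)%N => o ol nE.
have bs := block_sizeP s k.+1; set b := block_size s k.+1 in bs.
have E : (n + (lam.+1 + (k.+1 * l + b) - n) = lam.+1 + (k.+1 * l + b))%N.
  by rewrite mulSn; lia.
exists (lam.+1 + (k.+1 * l + b) - n)%N; first by rewrite -/l mulSn; rewrite /l in nE *; lia.
by rewrite E family_gt blocksE -/b ?ltnn ?subnn ?a_gt0//; lia.
Qed.

End Construction.

Lemma admissible_family a N : (forall n, lexlt (sh n.+1 a) a) ->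
  (forall n, lexlt (refl (sh n.+1 a)) a) ->
  exists (f : digits 1 -> digits M) (B l K : nat), [/\
    (0 < l)%N,
    forall s, agree N a (f s) /\ lexlt a (f s),
    forall s n, lexlt (sh n.+1 (f s)) (f s) /\ lexlt (sh n.+1 (refl (f s))) (f s),
    forall s t k, s k <> t k -> ~ agree (B + k * l) (f s) (f t) &
    forall s n, exists2 i, (i <= K)%N & (0 < f s (n + i))%N].
Proof.
move=> a_up a_lo.
have aa n : ~ lexlt a (sh n a).
  by case: n => [|n] h; [exact: lexlt_irr h|exact: lexlt_irr (lexlt_trans h (a_up n))].
have lo j : (0 <= j)%N -> lexlt (sh j (refl a)) a.
  move=> _; case: j => [|j]; last exact: a_lo.
  apply: lexlt_trans (a_up 0); rewrite -[sh 1 a]reflK; apply/lexlt_refl.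
  by apply: a_lo.
have up j : (1 <= j)%N -> lexlt (sh j a) a by case: j.
(* First a borderless prefix longer than [N], then [n1] beyond it and [n2] beyond [n1]. Borders
   concern proper suffixes, so the start is 1 here and 0 for the reflection. *)
have [[|lam] lamN unmatched_lam] := unmatched_positions N.+1 up aa; first by [].
have [n1 hn1 unmatched_n1] := unmatched_positions lam.+1 lo aa.
have [n2 hn2 unmatched_n2] := unmatched_positions n1 lo aa.
exists (family a n1 n2 lam), (lam.+1 + (n1 + n2))%N, (n1 + n2)%N, (lam + 2 * (n1 + n2))%N.
have lam0 : (0 < lam)%N by lia.
split; first lia.
- move=> s; split; last by apply: lexlt_family => //.
  by move=> i iN; apply: family_lt; lia.
- by move=> s n; split; [exact: family_up|exact: family_lo].
- by move=> s t k st; rewrite -addnA -mulSn; apply: family_inj.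
- by move=> s n; exact: family_gt0.
Qed.

End AdmissibleFamily.

(** * Separated families of univocal bases *)

Section UnivocalBases.
Variables (R : realType) (M : nat).
Implicit Types (d a : digits M) (p q r : R).

Lemma piq_lt1_lexlt q a d : 1 < q -> quasi_greedy q a -> piq q d < 1 -> lexlt d a.
Proof.
move=> q1 qa d1; have [//|E|h] := lexlt_total d a.
  by move: d1; rewrite E qa.1 ltxx.
by have := lexlt_piq q1 (quasi_greedy_bounds qa) h; rewrite qa.1 leNgt d1.
Qed.

(** Univocality controls a tail only after a digit below [M], or above 0 for the reflection. After a
    digit [M] the bound follows from q < M + 1; after a digit 0 it propagates from the preceding
    reflected tail. *)
Lemma univocal_admissible q a : 1 < q < M.+1%:R -> quasi_greedy q a ->
  univocal_seqs M q a ->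
  (forall n, lexlt (sh n.+1 a) a) /\ (forall n, lexlt (refl (sh n.+1 a)) a).
Proof.
move=> /andP[q1 qM] qa ua; have a1 := quasi_greedy_bounds qa.
have a0 := quasi_greedy_gt0 qa.
have q1M : 1 < q <= M.+1%:R by rewrite q1 ltW.
have [ta tr] := (univocalP a q1M).1 ua.
have rec n : q * piq q (sh n a) = (a n)%:R + piq q (sh n.+1 a).
  by rewrite (piqS (sh n a))// sh_sh addn1 /sh addn0; field; lra.
split=> n; apply: (piq_lt1_lexlt q1 qa).
  have [/ta//|Ma] := ltnP (a n) M.
  have : M%:R <= (a n)%:R :> R by rewrite ler_nat.
  have := rec n; have := a1 n; move: qM; rewrite -natr1 => *.
  suff : q * piq q (sh n a) <= q by lra.
  by rewrite -[leRHS]mulr1 ler_wpM2l//; lra.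
elim: n => [|n IH].
  apply: tr; rewrite refl_lt lt0n; apply/eqP => E; have := rec 0; rewrite E add0r.
  rewrite (_ : sh 0 a = a)//; rewrite qa.1; have := a1 1; lra.
have [an|an] := posnP (a n.+1); last first.
  by apply: tr; rewrite refl_lt.
move: IH; rewrite !piq_refl//; have := rec n.+1; rewrite an add0r => <-.
have : M%:R / (q - 1) = (q * (M%:R / (q - 1)) - M%:R) :> R by field; lra.
move: (M%:R / (q - 1)) (piq q _) => C x E h.
have : q * (C - x) < q by rewrite -[ltRHS]mulr1 ltr_pM2l//; lra.
by move: qM; rewrite -natr1; lra.
Qed.

Lemma piq_dist (m : R) p r d : 1 < m -> m <= p -> m <= r ->
  `|piq p d - piq r d| <= M%:R / (m - 1) ^+ 2 * `|p - r|.
Proof.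
move=> m1; wlog pr : p r / p <= r => [hw|mp _].
  have [pr|/ltW rp] := leP p r; first exact: hw.
  by move=> mp mr; rewrite distrC [`|p - r|]distrC hw.
have p1 : 1 < p by lra.
rewrite ger0_norm; last by rewrite subr_ge0 piq_base.
apply: le_trans (piq_lip d p1 pr) _.
rewrite distrC ger0_norm ?subr_ge0// ler_wpM2r ?subr_ge0// ler_wpM2l//.
rewrite lef_pV2 ?posrE ?exprn_gt0//; try lra.
by rewrite ler_pXn2r ?nnegrE//; lra.
Qed.

Lemma piq_continuous p d : 1 < p -> {for p, continuous (fun r => piq r d)}.
Proof.
move=> p1; apply/cvgrPdist_lt => e e0.
pose m := (1 + p) / 2; have [m1 mp] : 1 < m /\ m < p by rewrite /m; lra.
pose K := M%:R / (m - 1) ^+ 2 : R.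
have K0 : 0 <= K by rewrite divr_ge0// exprn_ge0//; lra.
have eK : 0 < e / (K + 1) by rewrite divr_gt0//; lra.
near=> r.
have mr : m <= r by apply: ltW; near: r; exact: lt_nbhsr.
apply: le_lt_trans (piq_dist d m1 (ltW mp) mr) _; rewrite -/K.
have : `|p - r| < e / (K + 1) by near: r; exact: cvgr_dist_lt.
rewrite ltr_pdivlMr; last lra.
have := normr_ge0 (p - r); nra.
Unshelve. all: by end_near. Qed.

Lemma base_exists q r d : 1 < q -> q < r -> 1 < piq q d -> piq r d < 1 ->
  exists2 p, q < p < r & piq p d = 1.
Proof.
move=> q1 qr dq dr.
have [||c] := @IVT R (fun p => piq p d) q r 1 (ltW qr).
- apply: continuous_in_subspaceT => p; rewrite inE/= in_itv/= => /andP[qp _].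
  by apply: piq_continuous; lra.
- by rewrite ge_min le_max (ltW dr) (ltW dq) orbT.
rewrite in_itv /= !le_eqVlt => /andP[/predU1P[<-|qc] /predU1P[->|cr]] dc; try lra.
by exists c; rewrite ?qc.
Qed.

(** Both dimension bounds use this family; [c] and [rho] serve all bases [p] up to M + 1. *)
Lemma univocal_family q r : (0 < M)%N -> 1 < q -> q < r <= M.+1%:R ->
  univocal_bases R M q ->
  exists (f : digits 1 -> digits M) (b : digits 1 -> R) (c rho : R), [/\
    0 < c, 0 < rho < 1,
    forall s, [/\ q < b s < r, piq (b s) (f s) = 1 & univocal_seqs M (b s) (f s)],
    forall s t k, s k <> t k -> f s <> f t &
    forall s t k p, 1 < p <= M.+1%:R -> s k <> t k -> lexlt (f t) (f s) ->
      tails_lt1 p (f t) -> c * rho ^+ k <= piq p (f s) - piq p (f t)].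
Proof.
move=> M0 q1 /andP[qr rM] Uq; have qM : q < M.+1%:R by lra.
have r1 : 1 < r by lra.
have [a qa] : exists a : digits M, quasi_greedy q a.
  by apply: quasi_greedy_exists; rewrite q1 ltW.
have qM' : 1 < q < M.+1%:R by rewrite q1.
have [a_up a_lo] := univocal_admissible qM' qa ((univocal_basesP q1 qa).1 Uq).
have ar : piq r a < 1.
  rewrite -qa.1; apply: piq_base_lt => //; apply: (piq_gt0 q1) => //.
  by rewrite qa.1.
have C0 : 0 < M%:R / (r - 1) by rewrite divr_gt0 ?ltr0n//; lra.
have ar0 : 0 < 1 - piq r a by rewrite subr_gt0.
(* Sharing [N] digits with [a] keeps the value in base [r] below 1, while exceeding [a] gives a
   value above 1 in base [q]; continuity yields a base in between. *)
have [N] := expVn_lt r1 (divr_gt0 ar0 C0).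
rewrite ltr_pdivlMr// => hN.
have [f [B [l [K [l0 f1 f2 f3 f4]]]]] := admissible_family N a_up a_lo.
have fpos p s n : 1 < p -> 0 < piq p (sh n (f s)).
  move=> p1; have [i _ fi] := f4 s n.
  exact: lt_le_trans (expV_gt0 i.+1 p1) (piq_digit p1 fi).
have /choice[b hb] : forall s, exists p, q < p < r /\ piq p (f s) = 1.
  move=> s; have [fa lt_f] := f1 s.
  have [||p hp hps] := @base_exists q r (f s) q1 qr.
  - rewrite -qa.1; apply: lexlt_piq_lt => //; first exact: quasi_greedy_bounds.
    by move=> k; exact: fpos.
  - rewrite (piq_split (f s) N)//; move: ar hN; rewrite (piq_split a N)//.
    rewrite (eq_bigr (fun i : 'I_N => (f s i)%:R * r ^- i.+1)); last first.
      by move=> i _; rewrite fa.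
    have rN := expV_gt0 N r1.
    have := ler_wpM2l (ltW rN) (piq_le (sh N (f s)) r1).
    have := mulr_ge0 (ltW rN) (piq_ge0 (sh N a) r1).
    lra.
  by exists p.
pose T := M.+1%:R : R; have T1 : 1 < T by rewrite ltr1n.
exists f, b, (T ^- (B + K.+1)), (T ^- l); split.
- exact: expV_gt0.
- have Tl : 1 < T ^+ l by rewrite exprn_egt1// -lt0n.
  have Tl0 : 0 < T ^+ l by exact: lt_trans Tl.
  by rewrite invr_gt0 Tl0 invf_lt1.
- move=> s; have [/andP[qb br] bs] := hb s; split=> //; first by rewrite qb.
  have b1 : 1 < b s by lra.
  have bp k : 0 < piq (b s) (sh k (f s)) by exact: fpos.
  apply: tails_lt1_univocal => //; apply: (lexlt_tails_lt1 b1 _ bp); rewrite ?bs// => n _.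
    by case: (f2 s n).
  by case: (f2 s n).
- by move=> s t k /f3 + E; apply; rewrite E.
(* The first difference lies below B + k l. The digit gain of 1 exceeds the tail of [f t], so at
   least the tail of [f s] remains, with a nonzero digit among its first K + 1. *)
move=> s t k p /andP[p1 pT] st [n hn lt_n] tt.
rewrite (piq_agree p1 (agree_sym hn)).
have nB : (n < B + k * l)%N.
  by rewrite ltnNge; apply/negP => h; apply: (f3 s t k st) => i hi; rewrite hn// (leq_trans hi).
have ft : piq p (sh n.+1 (f t)) < 1.
  by apply: tt; rewrite (leq_trans lt_n)// -ltnS.
have [i iK fi] := f4 s n.+1.
have fs := piq_digit (d := sh n.+1 (f s)) p1 fi.
have : (f t n)%:R + 1 <= (f s n)%:R :> R by rewrite natr1 ler_nat.
move=> h; apply: (@le_trans _ _ (p ^- n.+1 * p ^- i.+1)); last first.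
  by apply: ler_wpM2l; [exact/ltW/expV_gt0|lra].
rewrite exprVn -exprM -!invfM -!exprD.
rewrite lef_pV2 ?posrE ?exprn_gt0//; try lra.
apply: (@le_trans _ _ (T ^+ (n.+1 + i.+1))).
  by rewrite lerXn2r ?nnegrE//; lra.
by apply: ler_weXn2l; [exact: ltW|move: nB iK; clear; lia].
Qed.

End UnivocalBases.

(** * The equivalences, from separated families and countable gaps *)

Theorem theorem1p1 (R : realType) (M : nat) (M_ge1 : (1 <= M)%N)
    (q : R) (q_range : 1 < q <= M.+1%:R) :
  (univocal_bases R M q <->
     forall r : R, q < r <= M.+1%:R ->
       (0 < hausdorff_dim
              (piq (M.+1%:R : R) @` (univocal_seqs M r `\` univocal_seqs M q)))%E)
  /\
  (univocal_bases R M q <->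
     forall r : R, q < r <= M.+1%:R ->
       (0 < hausdorff_dim (univocal_bases R M `&` `]q, r[))%E).
Proof.
have /andP[q1 qM] := q_range.
(* M + 1 is itself univocal, which leaves q < M + 1 here. *)
have gap : ~ univocal_bases R M q -> exists2 r, q < r < M.+1%:R &
    countable (univocal_seqs M r `\` univocal_seqs M q).
  move=> nU; apply: countable_gap => //; rewrite q1 lt_neqAle qM andbT.
  by apply/eqP => E; apply: nU; rewrite E; exact: univocal_bases_top.
pose T := M.+1%:R : R; have T1 : 1 < T by rewrite ltr1n.
have T0 : 0 < T by lra.
split; split.
- move=> Uq r hr; have /andP[qr rM] := hr.
  have [f [b [c [rho [c0 rho01 hb fne sep]]]]] := univocal_family M_ge1 q1 hr Uq.
  have tf s : tails_lt1 T (f s).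
    have [/andP[qb br] _ ub] := hb s; have b1 : 1 < b s by lra.
    apply: (tails_lt1_base b1); first by rewrite /T; lra.
    by apply: univocal_tails_lt1 ub; rewrite b1; lra.
  (* The leading 0 divides distances in base [T] by [T], hence the constant c / T. *)
  apply: (@hausdorff_dim_gt0 _ _ (fun s => piq T (catd [:: ord0] (f s))) (c / T) rho) => //.
  + by rewrite divr_gt0.
  + move=> s; have [hq b1 ub] := hb s; exists (catd [:: ord0] (f s)) => //.
    exact: univocal_bases_seq ub.
  + have key s t k : s k <> t k -> lexlt (f t) (f s) -> c / T * rho ^+ k <=
        `|piq T (catd [:: ord0] (f s)) - piq T (catd [:: ord0] (f t))|.
      move=> st lt_f; rewrite (piqS (catd _ (f s)))// (piqS (catd _ (f t)))// !sh_cons.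
      rewrite /catd /= !add0r -mulrBl mulrAC; apply: le_trans (ler_norm _).
      apply: ler_wpM2r; first by rewrite invr_ge0 ltW.
      by apply: sep => //; rewrite T1 /=.
    move=> s t k _ st; have [h|E|h] := lexlt_total (f s) (f t).
    * by rewrite distrC; apply: key => // /esym.
    * by case: (fne s t k st).
    * exact: key.
- move=> hdim; apply: contrapT => /gap[r hr hc].
  have /andP[qr rM] := hr.
  have := hdim r; rewrite qr ltW// => /(_ isT); rewrite ltNge.
  rewrite hausdorff_dim_countable//; apply: sub_countable hc.
  exact: card_image_le.
- move=> Uq r hr; have /andP[qr rM] := hr.
  have [f [b [c [rho [c0 rho01 hb fne sep]]]]] := univocal_family M_ge1 q1 hr Uq.
  (* Lipschitz dependence on the base turns a separation of values into one of the bases. *)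
  pose K := M%:R / (q - 1) ^+ 2 : R.
  have K0 : 0 < K by rewrite divr_gt0 ?ltr0n// exprn_gt0//; lra.
  apply: (@hausdorff_dim_gt0 _ _ b (c / K) rho) => //.
  + by rewrite divr_gt0.
  + move=> s; have [hq b1 ub] := hb s; split; last by rewrite /= in_itv.
    split; first by lra.
    by exists (f s); split=> [|e he]; [rewrite /is_expansion b1|apply/esym/ub; rewrite /is_expansion b1].
  + have key s t k : s k <> t k -> lexlt (f t) (f s) -> c / K * rho ^+ k <= `|b s - b t|.
      move=> st lt_f; have [/andP[qs sr] bs us] := hb s; have [/andP[qt tr] bt ut] := hb t.
      have b1 : 1 < b t <= M.+1%:R by apply/andP; split; lra.
      have := sep s t k (b t) b1 st lt_f (univocal_tails_lt1 b1 ut).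
      have := piq_dist (f s) q1 (ltW qt) (ltW qs); rewrite -/K bt bs => h h'.
      rewrite mulrAC ler_pdivrMr// mulrC distrC [`|_| * K]mulrC.
      have := ler_norm (piq (b t) (f s) - 1); move: h h'; rewrite mulrC; lra.
    move=> s t k _ st; have [h|E|h] := lexlt_total (f s) (f t).
    * by rewrite distrC; apply: key => // /esym.
    * by case: (fne s t k st).
    * exact: key.
- move=> hdim; apply: contrapT => /gap[r hr hc].
  have /andP[qr rM] := hr.
  have := hdim r; rewrite qr ltW// => /(_ isT); rewrite ltNge.
  rewrite hausdorff_dim_countable//.
  have /choice[g hg] : forall p : R, exists d : digits M,
      (univocal_bases R M `&` `]q, r[) p ->
      piq p d = 1 /\ univocal_seqs M p d.
    move=> p; have [[p1 [d [d1 ud]]]|nU] := pselect (univocal_bases R M p).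
      exists d => _; split; first exact: esym.
      by move=> e he; apply/esym/ud; rewrite /is_expansion {}d1.
    by exists (fun=> ord0) => -[].
  have /countable_injP[h hinj] := hc.
  (* By strict monotonicity in the base, a sequence expands 1 in at most one base, so this map is
     injective. *)
  apply/countable_injP; exists (fun p => h (catd [:: ord0] (g p))) => x y.
  rewrite !inE => Ux Uy.
  have hx : 1 < x /\ q < x < r by case: Ux => -[? _] /=; rewrite in_itv.
  have hy : 1 < y /\ q < y < r by case: Uy => -[? _] /=; rewrite in_itv.
  have [gx ugx] := hg x Ux; have [gy ugy] := hg y Uy.
  have rM' := ltW rM.
  move/hinj; rewrite !inE => E.
  have {E} := E (univocal_bases_seq M_ge1 q1 hx.2 rM' gx ugx)
                (univocal_bases_seq M_ge1 q1 hy.2 rM' gy ugy).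
  move=> /(congr1 (sh 1)); rewrite !sh_cons.
  move=> E; have [xy|yx|//] := ltgtP x y.
    have := @piq_base_lt R M x y (g y) hx.1 xy; rewrite gy -E gx; lra.
  have := @piq_base_lt R M y x (g x) hy.1 yx; rewrite gx E gy; lra.
Qed.
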